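(* Let $n\ge2$ and let $\lambda$ be a Young diagram with $\ell(\lambda)<n$. Suppose that $\gcd(n,|\lambda|)=1$ and that $\mathsf{s}_i\cdot\mathsf{pr}^n=\mathsf{pr}^n\cdot\mathsf{s}_i$ on $\mathsf{SST}_n(\lambda)$ for all $i\in\{1,\dots,n-1\}$. Then the following hold. (1) For every $T\in\mathsf{SST}_n(\lambda)$, $|\mathcal{O}_{\mathsf{pr}}(T)|=|\mathcal{O}_{\mathsf{C}\times\mathsf{P}}(T)|$, where $\mathcal{O}_{\mathsf{pr}}(T)=\{\mathsf{pr}^k(T)\mid k\in\mathbb{Z}_{\ge0}\}$ and $\mathcal{O}_{\mathsf{C}\times\mathsf{P}}(T)=\{\mathsf{c}^a\,\mathsf{pr}^{bn}(T)\mid a,b\in\mathbb{Z}_{\ge0}\}$. (2) For $\alpha\in\mathbb{Z}_{\ge0}^n$ with $\mathsf{SST}_n(\lambda,\alpha)\ne\emptyset$, let $\mathfrak{o}_\lambda(\alpha)$ be the order of the restriction of $\mathsf{pr}^n$ to $\mathsf{SST}_n(\lambda,\alpha)$. Then the order of $\mathsf{pr}$ on $\mathsf{SST}_n(\lambda)$ equals $n\cdot\mathrm{lcm}\{\mathfrak{o}_\lambda(\alpha)\mid\alpha\in\mathrm{cont}^+(\lambda)\}$.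
   Context: Partitions are identified with Young diagrams (English convention); $\ell(\lambda)$ is the number of positive parts and $|\lambda|$ the number of boxes. $\mathsf{SST}_n(\lambda)$ is the set of semistandard tableaux of shape $\lambda$ with entries in $\{1,\dots,n\}$ (rows weakly increasing, columns strictly increasing). The content of $T$ is $\mathrm{cont}(T)=(c_1,\dots,c_n)$ with $c_k$ the number of entries $k$ in $T$; $\mathsf{SST}_n(\lambda,\alpha)=\{T\in\mathsf{SST}_n(\lambda):\mathrm{cont}(T)=\alpha\}$; $\mathrm{cont}(\lambda)$ is the set of contents of all $T\in\mathsf{SST}_n(\lambda)$, and $\mathrm{cont}^+(\lambda)$ is the set of $(a_1,\dots,a_n)\in\mathrm{cont}(\lambda)$ with $a_1\ge a_2\ge\cdots\ge a_n$. Products of operators are compositions, rightmost applied first. Crystal reflections: for $1\le i\le n-1$, $\mathsf{s}_i$ acts on $T\in\mathsf{SST}_n(\lambda)$ as follows. Read the entries row by row, each row left to right, from the bottom row to the top row; regard each $i+1$ as ''('' and each $i$ as '')'' and match parentheses in the usual way; the unmatched letters form a subword $i^a(i+1)^b$, which $\mathsf{s}_i$ replaces by $i^b(i+1)^a$ in the same positions. (This is the Weyl group action from the standard $U_q(\mathfrak{sl}_n)$-crystal structure; the $\mathsf{s}_i$ define an action of $\mathfrak{S}_n$.) Put $\mathsf{c}=\mathsf{s}_1\mathsf{s}_2\cdots\mathsf{s}_{n-1}$; $\mathsf{C}$ is the cyclic group of order $n$ generated by $\mathsf{c}$ and $\mathsf{P}$ is the cyclic group generated by $\mathsf{pr}^n$;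 under the hypotheses $\mathsf{C}\times\mathsf{P}$ acts on $\mathsf{SST}_n(\lambda)$. Promotion: for $T\in\mathsf{SST}_n(\lambda)$, $\mathsf{pr}(T)$ is obtained as follows. If $T$ has no entry $n$, add 1 to every entry. Otherwise replace each entry $n$ by a dot; process the dots from left to right, and slide each toward the northwest by jeu de taquin: repeatedly exchange the dot with the larger of the (non-dot) entries immediately above and immediately to the left of it (with the one above in case of equality, and with the only one available if just one exists), until there is no non-dot entry above or to the left. Finally add 1 to all remaining entries and replace all dots by 1. $\mathsf{pr}$ is a bijection of $\mathsf{SST}_n(\lambda)$, and $\mathsf{pr}^n$ preserves each $\mathsf{SST}_n(\lambda,\alpha)$. *)

(* Defs.v *)
From mathcomp Require Export all_boot.
From mathcomp Require Export boolp classical_sets cardinality fsbigop.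

(* The parts of a partition are positive, so l(la) is [size la] and |la| is
   [sumn la]. *)
Definition is_partition (la : seq nat) : Prop :=
  sorted geq la /\ all (fun p => 0 < p) la.

(* Rows are listed from top to bottom; rows and columns are numbered from 0. *)
Definition tableau := seq (seq nat).

(* [entry T i j] is 0 when (i, j) is not a box of T. *)
Definition entry (T : tableau) (i j : nat) : nat := nth 0 (nth [::] T i) j.

Definition SST (n : nat) (la : seq nat) : set tableau := fun T =>
  [/\ shape T = la,
      forall row, row \in T -> all (fun x => 1 <= x <= n) row,
      forall row, row \in T -> sorted leq row
    & forall i j, j < size (nth [::] T i.+1) -> entry T i j < entry T i.+1 j].

Definition content (n : nat) (T : tableau) : n.-tuple nat :=
  [tuple count_mem k.+1 (flatten T) | k < n].

Definition SST_content (n : nat) (la : seq nat) (al : n.-tuple nat) :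
    set tableau :=
  fun T => SST n la T /\ content n T = al.

Definition contents (n : nat) (la : seq nat) : set (n.-tuple nat) :=
  fun al => exists2 T, SST n la T & content n T = al.

Definition contents_plus (n : nat) (la : seq nat) : set (n.-tuple nat) :=
  fun al => contents n la al /\ sorted geq al.

(* Rows from bottom to top, each row from left to right. *)
Definition reading_word (T : tableau) : seq nat := flatten (rev T).

Definition of_reading_word (la : seq nat) (w : seq nat) : tableau :=
  rev (reshape (rev la) w).

(* The increasing list of the positions of the unmatched letters, where i.+1 is
   "(" and i is ")".  The scan has reached position p; [opened] is the stack of
   positions of the pending "(", and [closed] lists the positions of the
   unmatched ")".  An unmatched ")" only occurs when no "(" is pending, so all
   the unmatched ")" precede all the unmatched "(". *)
Fixpoint unmatched_from (i : nat) (opened closed : seq nat) (p : nat)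
    (w : seq nat) : seq nat :=
  if w is x :: w' then
    if x == i.+1 then unmatched_from i (p :: opened) closed p.+1 w'
    else if x == i then
      if opened is _ :: opened' then unmatched_from i opened' closed p.+1 w'
      else unmatched_from i [::] (rcons closed p) p.+1 w'
    else unmatched_from i opened closed p.+1 w'
  else closed ++ rev opened.

Definition unmatched (i : nat) (w : seq nat) : seq nat :=
  unmatched_from i [::] [::] 0 w.

(* The unmatched subword i^a (i+1)^b becomes i^b (i+1)^a. *)
Definition reflection_word (i : nat) (w : seq nat) : seq nat :=
  let u := unmatched i w in
  let b := count (fun p => nth 0 w p == i.+1) u in
  mkseq (fun p => if p \in u then if index p u < b then i else i.+1
                  else nth 0 w p) (size w).

Definition reflection (i : nat) (T : tableau) : tableau :=
  of_reading_word (shape T) (reflection_word i (reading_word T)).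

(* s_1 s_2 ... s_(n-1), the rightmost factor being applied first. *)
Definition crystal_c (n : nat) (T : tableau) : tableau :=
  foldr reflection T (iota 1 n.-1).

(* During promotion a dot is an entry 0: in [above] and [left_of] the value 0
   thus means that there is no box, or a box holding a dot. *)
Definition above (T : tableau) (i j : nat) : nat :=
  if i is i'.+1 then entry T i' j else 0.

Definition left_of (T : tableau) (i j : nat) : nat :=
  if j is j'.+1 then entry T i j' else 0.

Definition set_entry (T : tableau) (i j x : nat) : tableau :=
  set_nth [::] T i (set_nth 0 (nth [::] T i) j x).

(* Slides the dot at (i, j).  Each step decreases i + j by one, so the fuel
   i + j is enough to reach the final position. *)
Fixpoint slide (fuel : nat) (T : tableau) (i j : nat) : tableau :=
  if fuel is fuel'.+1 then
    let a := above T i j in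
    let l := left_of T i j in
    if (a == 0) && (l == 0) then T
    else if l <= a then
      slide fuel' (set_entry (set_entry T i j a) i.-1 j 0) i.-1 j
    else
      slide fuel' (set_entry (set_entry T i j l) i j.-1 0) i j.-1
  else T.

(* The boxes (row, column) with entry n, in increasing order of columns. *)
Definition dots (n : nat) (T : tableau) : seq (nat * nat) :=
  [seq p <- [seq (i, j) | j <- iota 0 (size (head [::] T)),
                          i <- iota 0 (size T)] | entry T p.1 p.2 == n].

Definition promotion (n : nat) (T : tableau) : tableau :=
  let T0 := [seq [seq if x == n then 0 else x | x <- row] | row <- T] in
  let T1 := foldl (fun U p => slide (p.1 + p.2) U p.1 p.2) T0 (dots n T) in
  [seq [seq if x == 0 then 1 else x + 1 | x <- row] | row <- T1].

Definition orbit_pr (n : nat) (T : tableau) : set tableau :=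
  fun U => exists k, U = iter k (promotion n) T.

Definition orbit_CP (n : nat) (T : tableau) : set tableau :=
  fun U => exists a b, U = iter a (crystal_c n) (iter (b * n) (promotion n) T).

(* m is the order of the restriction of f to A. *)
Definition is_order {X : Type} (f : X -> X) (A : set X) (m : nat) : Prop :=
  [/\ 0 < m,
      forall x, A x -> iter m f x = x
    & forall k, 0 < k -> (forall x, A x -> iter k f x = x) -> m <= k].

(* The order of the restriction of f to A, or 0 if it has no finite order. *)
Definition order_on {X : Type} (f : X -> X) (A : set X) : nat :=
  xget 0 (is_order f A).

(* Main.v *)
Require Import Defs.
From mathcomp Require Import zify.

(** Modulo n, both promotion and the crystal element c add |la| to the sum of
    the entries of a tableau; as |la| is prime to n, a power of either of them
    can only fix a tableau if its exponent is divisible by n.  Since c^n = 1,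
    both orbits of T have n times as many elements as the orbit of T under
    pr^n.  For the order, a reflection s_i with c_i < c_(i+1) decreases the sum
    of the entries, so every tableau is carried to one of dominant content by
    reflections, which commute with pr^n.

    The relation c^n = 1 comes from the Coxeter relations.  A word is
    determined by its image under the maximal raising operator e_i^max and by
    the number eps_i of raising steps, and s_i exchanges eps_i with phi_i.  The
    braid relation is therefore a piecewise linear identity between the string
    parameters along e_1 e_2 e_1 and e_2 e_1 e_2, whose transition formula is
    proved by induction on the word.

    Promotion is treated dot by dot.  A slide is a sequence of moves of the dot
    that can be traced back, and each dot stays to the right of the path of the
    previous one, so that the dots end up at the beginning of the first row. *)

Local Open Scope card_scope.
Local Open Scope nat_scope.

(** * Raising operators and reflections on words *)

Ltac decide_eqs := repeat (match goal with
  |- context [@eq_op _ ?a ?b] =>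
    first [have -> : (a == b) = false by lia | have -> : (a == b) = true by lia]
  end; rewrite /=).

(* phi and eps count the unmatched letters i and i+1 of the bracketing, and
   raise is e_i^max; the recursion scans the word from the right. *)
Fixpoint phi (i : nat) (w : seq nat) : nat :=
  if w is x :: w' then
    if x == i.+1 then (phi i w').-1
    else if x == i then (phi i w').+1 else phi i w'
  else 0.

Fixpoint eps (i : nat) (w : seq nat) : nat :=
  if w is x :: w' then
    if (x == i.+1) && (phi i w' == 0) then (eps i w').+1 else eps i w'
  else 0.

Fixpoint raise (i : nat) (w : seq nat) : seq nat :=
  if w is x :: w' then
    (if (x == i.+1) && (phi i w' == 0) then i else x) :: raise i w'
  else [::].

(** The letters that [raise] turns from i+1 into i stay unmatched. *)
Lemma phi_raise i w : phi i (raise i w) = phi i w + eps i w.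
Proof.
elim: w => //= x w IH.
case: (x =P i.+1) => [->|ne] /=; last first.
  by case: (x =P i) => _; have := IH; case: eqP => //=; lia.
case: (phi i w =P 0) => [p0|pn] /=; last by rewrite !eqxx IH; lia.
by rewrite eqxx (_ : (i == i.+1) = false) ?IH; lia.
Qed.

(* phi (raise w) = phi w + eps w, so tails with different eps would give the
   larger one a negative phi. *)
Lemma raise_eps_inj i w w' :
  raise i w = raise i w' -> eps i w = eps i w' -> w = w'.
Proof.
elim: w w' => [|x w IH] [|x' w'] //= [].
move=> hx hw he.
have hp : phi i w + eps i w = phi i w' + eps i w' by rewrite -!phi_raise hw.
move: hx he.
case: (x =P i.+1) => [->|ne]; case: (x' =P i.+1) => [->|ne'] /=;
  do ?case: eqP => //= ?; intros; try lia; subst;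
  by congr (_ :: _); apply: IH => //; lia.
Qed.

(** Every bracketed pair contains one i and one i+1. *)
Lemma phi_eps_count i w :
  phi i w + count_mem i.+1 w = eps i w + count_mem i w.
Proof.
elim: w => //= x w IH.
by do ?case: eqP => //= *; lia.
Qed.

Lemma count_raise i k w : count_mem k (raise i w) + (k == i.+1) * eps i w =
  count_mem k w + (k == i) * eps i w.
Proof.
elim: w => [|x w IH] //=; first lia.
move: IH; case: (x =P i.+1) => [->|?]; case: (phi i w =P 0) => ? /=;
  by do ?case: eqP => //= *; lia.
Qed.

Lemma sumn_raise i w : sumn (raise i w) + eps i w = sumn w.
Proof.
elim: w => //= x w IH.
by do ?case: eqP => //= *; lia.
Qed.

(* The string parameters of a word in the letters i, i+1, i+2 along the two
   reduced words of the longest permutation. *)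
Lemma raise_string i w (j := i.+1) :
  [/\ raise i (raise j (raise i w)) = raise j (raise i (raise j w)),
      eps j w = maxn (eps i (raise j (raise i w)))
                     (eps j (raise i w) - eps i w),
      eps i (raise j w) = eps i w + eps i (raise j (raise i w)),
      eps j (raise i (raise j w)) =
        minn (eps i w) (eps j (raise i w) - eps i (raise j (raise i w)))
    & eps i (raise j (raise i w)) <= eps j (raise i w)].
Proof.
rewrite {}/j.
elim: w => //= x w.
(* The letter counts express the difference of [phi] and [eps] for every word involved. Together
   with the induction hypothesis they make the inconsistent combinations of zero tests below
   refutable by linear arithmetic. *)
have := phi_eps_count i w; have := phi_eps_count i.+1 w.
have := phi_eps_count i.+1 (raise i w); have := phi_eps_count i (raise i.+1 w).
have := phi_eps_count i (raise i.+1 (raise i w)).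
have := phi_eps_count i.+1 (raise i (raise i.+1 w)).
have C := count_raise.
have := C i i w; have := C i i.+1 w; have := C i i.+2 w.
have := C i.+1 i w; have := C i.+1 i.+1 w; have := C i.+1 i.+2 w.
have := C i i (raise i.+1 w); have := C i i.+1 (raise i.+1 w).
have := C i i.+2 (raise i.+1 w).
have := C i.+1 i (raise i w); have := C i.+1 i.+1 (raise i w).
have := C i.+1 i.+2 (raise i w).
have := C i i (raise i.+1 (raise i w)); have := C i i.+1 (raise i.+1 (raise i w)).
have := C i.+1 i.+1 (raise i (raise i.+1 w)); have := C i.+1 i.+2 (raise i (raise i.+1 w)).
have -> : (i == i.+1) = false by lia.
have -> : (i == i.+2) = false by lia.
have -> : (i.+1 == i.+2) = false by lia.
have -> : (i.+1 == i) = false by lia.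
have -> : (i.+2 == i) = false by lia.
have -> : (i.+2 == i.+1) = false by lia.
rewrite !eqxx !mul1n !mul0n !addn0.
move: {C} (count_mem i w) (count_mem i.+1 w) (count_mem i.+2 w) => c1 c2 c3.
move=> h1 h2 h3 h4 h5 h6 h7 h8 h9 h10 h11 h12 h13 h14 h15 h16 h17 h18 h19 h20 h21 h22.
case=> -> i1 i2 i3 i4.
have f0 k : (k == k.+1) = false by lia.
have f1 k : (k.+1 == k) = false by lia.
have f2 k : (k == k.+2) = false by lia.
have f3 k : (k.+2 == k) = false by lia.
case: (x =P i) => [->|/eqP/negPf n1];
  [|case: (x =P i.+1) => [->|/eqP/negPf n2];
  [|case: (x =P i.+2) => [->|/eqP/negPf n3]]].
4: by rewrite /= ?(n1, n2, n3) /= ?(n1, n2, n3) /=; split.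
all: rewrite /= ?eqxx ?f0 ?f1 ?f2 ?f3 /=.
all: repeat match goal with |- context [phi ?a ?b == 0] =>
  case: (phi a b =P 0) => ?; rewrite /= ?eqxx ?f0 ?f1 ?f2 ?f3 /= end.
all: try (by exfalso; lia).
all: by split; [ | lia..].
Qed.

Lemma raise_far i j w : i.+1 < j ->
  [/\ raise i (raise j w) = raise j (raise i w), phi i (raise j w) = phi i w,
      eps i (raise j w) = eps i w, phi j (raise i w) = phi j w
    & eps j (raise i w) = eps j w].
Proof.
move=> ij; elim: w => //= x w [-> -> -> -> ->].
case: (x =P i) => [->|n1]; [|case: (x =P i.+1) => [->|n2];
  [|case: (x =P j) => [->|n3]; [|case: (x =P j.+1) => [->|n4]]]];
  case: (phi i w =P 0) => ?; case: (phi j w =P 0) => ?;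
  by rewrite /=; decide_eqs.
Qed.

(** * The bracketing rule in terms of [phi] and [eps] *)

Section Reflect.
Variables (i b : nat).

(* Left-to-right computation of the reflection: m pending i+1's, t unmatched
   letters already met, of which the first b become i.  An i is matched iff
   m > 0, and an i+1 iff phi is positive on the letters to its right. *)
Fixpoint reflect_from (m t : nat) (w : seq nat) : seq nat :=
  if w is x :: w' then
    if x == i.+1 then
      if phi i w' == 0 then (if t < b then i else i.+1) :: reflect_from m.+1 t.+1 w'
      else x :: reflect_from m.+1 t w'
    else if x == i then
      if m == 0 then (if t < b then i else i.+1) :: reflect_from 0 t.+1 w'
      else x :: reflect_from m.-1 t w'
    else x :: reflect_from m t w'
  else [::].

(** The [m] pending letters match the first unmatched letters i of [w]. The other [N] unmatched
    letters of [w] are unmatched in the whole word, and the first [b - t] of them become i. All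
    unmatched letters stay unmatched, so [raise] has the same value on both words. *)
Lemma reflect_from_string m t w (N := phi i w - m + eps i w) :
  [/\ raise i (reflect_from m t w) = raise i w,
      phi i (reflect_from m t w) = minn m (phi i w) + minn (b - t) N
    & eps i (reflect_from m t w) = N - minn (b - t) N].
Proof.
rewrite {}/N; elim: w m t => [|x w IH] m t /=; first by split => //; lia.
case: (x =P i.+1) => [->|/eqP/negPf n1] /=.
  case: (phi i w =P 0) => p0 /=.
    have [h1 h2 h3] := IH m.+1 t.+1.
    case: (ltnP t b) => tb /=; decide_eqs; rewrite h1.
      by split=> //; lia.
    have [z|nz] := eqVneq (phi i (reflect_from m.+1 t.+1 w)) 0; last by lia.
    by rewrite z; split=> //; lia.
  have [h1 h2 h3] := IH m.+1 t; decide_eqs; rewrite h1.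
  by split=> //; lia.
case: (x =P i) => [->|/eqP/negPf n2] /=; last first.
  have [h1 h2 h3] := IH m t; rewrite n1 n2 h1 h2 h3; split=> //.
case: (m =P 0) => [->|m0] /=; last first.
  have [h1 h2 h3] := IH m.-1 t; decide_eqs; rewrite h1.
  by split=> //; lia.
have [h1 h2 h3] := IH 0 t.+1.
case: (ltnP t b) => tb /=; decide_eqs; rewrite h1; split=> //; lia.
Qed.

(** An i+1 with an unmatched i on its right is bracketed with the nearest one, the first position of
    the list; hence [behead]. *)
Fixpoint unmatched_pos (p : nat) (w : seq nat) : seq nat :=
  if w is x :: w' then
    if x == i.+1 then
      if phi i w' == 0 then p :: unmatched_pos p.+1 w'
      else behead (unmatched_pos p.+1 w')
    else if x == i then p :: unmatched_pos p.+1 w' else unmatched_pos p.+1 w'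
  else [::].

Lemma unmatched_pos_ge p w : all (geq^~ p) (unmatched_pos p w).
Proof.
elim: w p => //= x w IH p.
have H : all (geq^~ p) (unmatched_pos p.+1 w).
  by apply: sub_all (IH p.+1) => y /= ; lia.
case: eqP => [_|_]; first case: eqP => _ /=; rewrite ?leqnn ?H //.
  by case: (unmatched_pos p.+1 w) H => //= ? ? /andP[].
by case: eqP => //= _; rewrite leqnn.
Qed.

Lemma unmatched_pos_letters p w : [seq nth 0 w (q - p) | q <- unmatched_pos p w] =
  nseq (phi i w) i ++ nseq (eps i w) i.+1.
Proof.
elim: w p => //= x w IH p.
have H : [seq nth 0 (x :: w) (q - p) | q <- unmatched_pos p.+1 w] =
    nseq (phi i w) i ++ nseq (eps i w) i.+1.
  rewrite -(IH p.+1); apply/eq_in_map => q /(allP (unmatched_pos_ge p.+1 w)) /= pq.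
  by have -> : q - p = (q - p.+1).+1 by lia.
case: eqP => [xi|_].
  case: eqP => p0 /=; first by rewrite subnn H p0 /= xi.
  by rewrite -behead_map H; case: (phi i w) p0.
by case: eqP => [xi|_] //=; rewrite subnn H /= xi.
Qed.

(** The first unmatched letters i of [w] match the positions on top of the stack. Dropping both
    leaves the rest of the stack, oldest position first, and the rest of [unmatched_pos]. *)
Lemma unmatched_fromE opened closed p w : unmatched_from i opened closed p w =
  closed ++ rev (drop (phi i w) opened) ++ drop (minn (size opened) (phi i w)) (unmatched_pos p w).
Proof.
elim: w opened closed p => [|x w IH] opened closed p /=.
  by rewrite drop0 cats0.
case: eqP => [_|_].
  rewrite IH; case: eqP => [->|p0] /=.
    by rewrite ?minn0 ?drop0 rev_cons -cats1 -!catA.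
  case E : (phi i w) p0 => [|k] //= _.
  have -> : minn (size opened).+1 k.+1 = (minn (size opened) k).+1 by lia.
  by case: (unmatched_pos p.+1 w) => //=; rewrite -?drop_drop.
case: eqP => [_|_]; last by rewrite IH.
case: opened => [|q opened]; rewrite IH /=.
  by rewrite ?min0n ?drop0 cat_rcons.
have -> : minn (size opened).+1 (phi i w).+1 = (minn (size opened) (phi i w)).+1 by lia.
by [].
Qed.

(** Before position [p] the unmatched letters are those in [closed] and the pending ones that [w]
    does not match. Their number is the counter given to [reflect_from], and the unmatched positions
    of [w] are indexed from it. *)
Lemma nth_reflect_from opened closed p w q
    (u := unmatched_from i opened closed p w) :
  all (ltn^~ p) opened -> all (ltn^~ p) closed -> q < size w ->
  nth 0 (reflect_from (size opened) (size closed + (size opened - phi i w)) w) q =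
  if p + q \in u then if index (p + q) u < b then i else i.+1 else nth 0 w q.
Proof.
rewrite {}/u; elim: w opened closed p q => //= x w IH opened closed p q ho hc hq.
have ho' : all (ltn^~ p.+1) opened by apply: sub_all ho => y /=; lia.
have hc' : all (ltn^~ p.+1) closed by apply: sub_all hc => y /=; lia.
have notin k : p \in drop k (unmatched_pos p.+1 w) = false.
  apply/negbTE/negP => /mem_drop /(allP (unmatched_pos_ge _ _)) /=; lia.
have notinA k : p \in closed ++ rev (drop k opened) = false.
  apply/negbTE/negP; rewrite mem_cat mem_rev => /orP[/(allP hc)|/mem_drop/(allP ho)] /=; lia.
have head k B (u := closed ++ rev (drop k opened) ++ B) :
    (p \in u = (p \in B)) * (index p u = size closed + (size opened - k) + index p B).
  by rewrite /u catA mem_cat index_cat notinA /= size_cat size_rev size_drop.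
case: q hq => [_|q]; last first.
  rewrite ltnS addnS => hq.
  have {}IH o c (u := unmatched_from i o c p.+1 w) :
      all (ltn^~ p.+1) o -> all (ltn^~ p.+1) c ->
      (if (p + q).+1 \in u then if index (p + q).+1 u < b then i else i.+1
       else nth 0 w q) =
      nth 0 (reflect_from (size o) (size c + (size o - phi i w)) w) q.
    by move=> *; rewrite -addSn (IH _ _ p.+1).
  case: (x =P i.+1) => [_|_]; last case: (x =P i) => [_|_].
  - case: (phi i w =P 0) => p0 /=; rewrite IH //= ?ltnSn //.
      by rewrite p0 /= !subn0 addnS.
    by congr nth; congr reflect_from; lia.
  - case: opened ho ho' {notinA head} => [|y opened] /=.
      move=> _ _; rewrite IH //= ?all_rcons /= ?ltnSn //.
      by congr nth; congr reflect_from; rewrite size_rcons; lia.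
    move=> /andP[_ ho] /andP[_ ho']; by rewrite IH.
  - by rewrite /= IH.
rewrite addn0.
have := unmatched_fromE opened closed p (x :: w); rewrite /= => ->.
case: (x =P i.+1) => [_|_]; last case: (x =P i) => [_|_].
- case: (phi i w =P 0) => [->|p0] /=.
    by rewrite !head ?minn0 ?drop0 /= inE eqxx /= addn0.
  rewrite !head ifF //; apply/negbTE/negP => /mem_drop/mem_behead.
  by rewrite -[unmatched_pos _ _]drop0 notin.
- case: (size opened =P 0) => [|s0] /=.
    by move/size0nil => s0; rewrite !head s0 min0n drop0 /= inE eqxx /= addn0.
  rewrite !head; case: (size opened) s0 => [|s] // _.
  have -> : minn s.+1 (phi i w).+1 = (minn s (phi i w)).+1 by lia.
  by rewrite /= notin.
- by rewrite !head notin.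
Qed.

Lemma size_reflect_from m t w : size (reflect_from m t w) = size w.
Proof.
by elim: w m t => //= x w IH m t; do 2 (case: eqP => _ //=; rewrite ?IH //); case: eqP => _ /=; rewrite IH.
Qed.
End Reflect.

(** * The reflections on words and the Coxeter relations *)

Lemma reflection_wordE i w : reflection_word i w = reflect_from i (eps i w) 0 0 w.
Proof.
rewrite /reflection_word.
have -> : count (fun p => nth 0 w p == i.+1) (unmatched i w) = eps i w.
  rewrite /unmatched unmatched_fromE /= min0n drop0.
  have := unmatched_pos_letters i 0 w; rewrite (eq_map (g := nth 0 w)); last by move=> q; rewrite subn0.
  rewrite -(count_map (nth 0 w) (pred1 i.+1)) => ->.
  rewrite count_cat !count_nseq /= eqxx mul1n.
  by have -> : (i == i.+1) = false by lia.
apply: (@eq_from_nth _ 0); rewrite size_mkseq ?size_reflect_from // => q hq.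
rewrite nth_mkseq // -[LHS]/(if 0 + q \in unmatched_from i [::] [::] 0 w then _ else _).
by rewrite -(@nth_reflect_from i _ [::] [::] 0).
Qed.

(** By [raise_eps_inj] the first and third equations determine s_i. Involutivity, contents and the
    Coxeter relations follow from these equations and the properties of [raise]. *)
Lemma reflection_word_string i w :
  [/\ raise i (reflection_word i w) = raise i w,
      phi i (reflection_word i w) = eps i w
    & eps i (reflection_word i w) = phi i w].
Proof.
rewrite reflection_wordE; have [-> -> ->] := reflect_from_string i (eps i w) 0 0 w.
by split=> //; lia.
Qed.

Lemma reflection_wordK i : involutive (reflection_word i).
Proof.
move=> w; have [h1 h2 h3] := reflection_word_string i w.
have [k1 k2 k3] := reflection_word_string i (reflection_word i w).
by apply: (@raise_eps_inj i); congruence.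
Qed.

Lemma count_reflection_word i w k : count_mem k (reflection_word i w) =
  count_mem (if k == i then i.+1 else if k == i.+1 then i else k) w.
Proof.
have [h1 h2 h3] := reflection_word_string i w.
have := count_raise i k (reflection_word i w); have := count_raise i k w.
have := phi_eps_count i w; rewrite h1 h3.
case: (k =P i) => [->|?]; first by decide_eqs; lia.
by case: (k =P i.+1) => [->|?]; lia.
Qed.

Lemma sumn_reflection_word i w :
  sumn (reflection_word i w) + count_mem i.+1 w = sumn w + count_mem i w.
Proof.
have [h1 h2 h3] := reflection_word_string i w.
have := sumn_raise i (reflection_word i w); have := sumn_raise i w.
have := phi_eps_count i w; rewrite h1 h3; lia.
Qed.

Lemma size_reflection_word i w : size (reflection_word i w) = size w.
Proof. exact: size_mkseq. Qed.

Lemma reflection_word_far i j w : i.+1 < j ->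
  reflection_word i (reflection_word j w) = reflection_word j (reflection_word i w).
Proof.
move=> ij; pose s := reflection_word.
have str k v : [/\ raise k (s k v) = raise k v, phi k (s k v) = eps k v
  & eps k (s k v) = phi k v] := reflection_word_string k v.
have inj v v' : raise i (raise j v) = raise i (raise j v') ->
  eps i v = eps i v' -> eps j v = eps j v' -> v = v'.
  move=> h1 h2 h3; apply: (raise_eps_inj _ _ _ _ h3); apply: (raise_eps_inj _ _ _ h1).
  by have [_ _ -> _ _] := raise_far i j v ij; have [_ _ -> _ _] := raise_far i j v' ij.
(* phi and eps at i only depend on raise j, and conversely *)
have ti v : (phi i (s j v) = phi i v) * (eps i (s j v) = eps i v).
  have [_ a1 a2 _ _] := raise_far i j (s j v) ij; have [_ b1 b2 _ _] := raise_far i j v ij.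
  by rewrite -a1 -a2 -b1 -b2; have [-> _ _] := str j v.
have tj v : (phi j (s i v) = phi j v) * (eps j (s i v) = eps j v).
  have [_ _ _ a1 a2] := raise_far i j (s i v) ij; have [_ _ _ b1 b2] := raise_far i j v ij.
  by rewrite -a1 -a2 -b1 -b2; have [-> _ _] := str i v.
apply: inj.
- have [-> _ _ _ _] := raise_far i j (s i (s j w)) ij; have [-> _ _] := str i (s j w).
  have [<- _ _ _ _] := raise_far i j (s j w) ij; have [-> _ _] := str j w.
  have [-> _ _] := str j (s i w).
  have [-> _ _ _ _] := raise_far i j (s i w) ij; have [-> _ _] := str i w.
  by have [-> _ _ _ _] := raise_far i j w ij.
- by have [_ _ ->] := str i (s j w); rewrite !ti; have [_ _ ->] := str i w.
- by rewrite tj; have [_ _ ->] := str j w; have [_ _ ->] := str j (s i w); rewrite tj.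
Qed.

Lemma reflection_word_braid i w (s := reflection_word) :
  s i (s i.+1 (s i w)) = s i.+1 (s i (s i.+1 w)).
Proof.
rewrite {}/s; pose s := reflection_word.
have str k v : [/\ raise k (s k v) = raise k v, phi k (s k v) = eps k v
  & eps k (s k v) = phi k v] := reflection_word_string k v.
(* A word is determined by its image under the three raisings and its three string parameters. *)
have inj v v' : raise i (raise i.+1 (raise i v)) = raise i (raise i.+1 (raise i v')) ->
    eps i v = eps i v' -> eps i.+1 (raise i v) = eps i.+1 (raise i v') ->
    eps i (raise i.+1 (raise i v)) = eps i (raise i.+1 (raise i v')) -> v = v'.
  move=> h1 h2 h3 h4; apply: (raise_eps_inj _ _ _ _ h2); apply: (raise_eps_inj _ _ _ _ h3).
  exact: (raise_eps_inj _ _ _ h1).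
pose u := s i (s i.+1 (s i w)); pose v := s i.+1 (s i (s i.+1 w)).
rewrite -[LHS]/u -[RHS]/v.
have top_i x : raise i (raise i.+1 (raise i (s i x))) = raise i (raise i.+1 (raise i x)).
  by have [-> _ _] := str i x.
have top_j x : raise i (raise i.+1 (raise i (s i.+1 x))) = raise i (raise i.+1 (raise i x)).
  have [-> _ _ _ _] := raise_string i (s i.+1 x); have [-> _ _] := str i.+1 x.
  by have [-> _ _ _ _] := raise_string i x.
have F x : [/\ phi i x + count_mem i.+1 x = eps i x + count_mem i x
   & phi i.+1 x + count_mem i.+2 x = eps i.+1 x + count_mem i.+1 x] by rewrite !phi_eps_count.
have Ci x : [/\ count_mem i (s i x) = count_mem i.+1 x, count_mem i.+1 (s i x) = count_mem i x
  & count_mem i.+2 (s i x) = count_mem i.+2 x].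
  by rewrite !count_reflection_word; decide_eqs.
have Cj x : [/\ count_mem i (s i.+1 x) = count_mem i x, count_mem i.+1 (s i.+1 x) = count_mem i.+2 x
  & count_mem i.+2 (s i.+1 x) = count_mem i.+1 x].
  by rewrite !count_reflection_word; decide_eqs.
(* s_i changes only the first parameter along i, i+1, i, and s_(i+1) only the first one along i+1,
   i, i+1. *)
have Ei x : [/\ eps i (s i x) = phi i x, eps i.+1 (raise i (s i x)) = eps i.+1 (raise i x)
  & eps i (raise i.+1 (raise i (s i x))) = eps i (raise i.+1 (raise i x))].
  by have [-> _ ->] := str i x.
have Ej x : [/\ eps i.+1 (s i.+1 x) = phi i.+1 x, eps i (raise i.+1 (s i.+1 x)) = eps i (raise i.+1 x)
  & eps i.+1 (raise i (raise i.+1 (s i.+1 x))) = eps i.+1 (raise i (raise i.+1 x))].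
  by have [-> _ ->] := str i.+1 x.
have K : [/\ eps i u = eps i v, eps i.+1 (raise i u) = eps i.+1 (raise i v)
   & eps i (raise i.+1 (raise i u)) = eps i (raise i.+1 (raise i v))].
  (* The transition formula, with its maximum and minimum resolved into two cases. *)
  have D x (x1 := eps i x) (x2 := eps i.+1 (raise i x))
      (x3 := eps i (raise i.+1 (raise i x))) (y1 := eps i.+1 x)
      (y2 := eps i (raise i.+1 x)) (y3 := eps i.+1 (raise i (raise i.+1 x))) :
      x1 + x3 = y2 /\ y1 + y3 = x2 /\
      (x2 <= x1 + x3 /\ y1 = x3 \/ x1 + x3 <= x2 /\ y3 = x1).
    by rewrite /x1 /x2 /x3 /y1 /y2 /y3; have [_ -> -> -> ?] := raise_string i x; lia.
  have := D w; have := D (s i w); have := D (s i.+1 w).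
  have := D (s i (s i.+1 w)); have := D (s i.+1 (s i w)).
  have := D u; have := D v.
  rewrite /u /v.
  have [-> -> ->] := Ei (s i.+1 (s i w)); have [-> -> ->] := Ej (s i (s i.+1 w)).
  have [] := F (s i (s i.+1 w)); have [] := F (s i.+1 (s i w)).
  have [] := F (s i w); have [] := F (s i.+1 w); have [] := F w.
  have [-> -> ->] := Ci (s i.+1 w); have [-> -> ->] := Cj (s i w).
  have [-> -> ->] := Ci w; have [-> -> ->] := Cj w.
  have [] := Ei (s i.+1 w); have [] := Ej (s i w).
  have [] := Ei w; have [] := Ej w.
  (* Only numbers remain. Each of the seven words met on the two sides of the relation contributes
     one alternative, and the inconsistent branches are pruned on the way. *)
  clear.
  repeat match goal with |- context [count_mem ?a ?b] => move: (count_mem a b) => ? end.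
  repeat match goal with |- context [eps ?a ?b] => move: (eps a b) => ? end.
  repeat match goal with |- context [phi ?a ?b] => move: (phi a b) => ? end.
  do 22 move=> ?.
  move=> [? [? e1]] [? [? e2]] [? [? e3]] [? [? e4]] [? [? e5]] [? [? e6]] [? [? e7]].
  case: e7 => - [? ?]; case: e6 => - [? ?]; try lia; case: e5 => - [? ?]; try lia;
   case: e4 => - [? ?]; try lia; case: e3 => - [? ?]; try lia; case: e2 => - [? ?]; try lia;
   case: e1 => - [? ?]; try lia; by split; lia.
have [k1 k2 k3] := K.
by apply: inj => //; rewrite /u /v !(top_i, top_j).
Qed.

(** * The order of a Coxeter element *)

Section CoxeterElement.
Variables (X : Type) (s : nat -> X -> X).
Hypothesis sK : forall i, involutive (s i).
Hypothesis s_far : forall i j x, i.+1 < j -> s i (s j x) = s j (s i x).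
Hypothesis s_braid : forall i x, s i (s i.+1 (s i x)) = s i.+1 (s i (s i.+1 x)).

Let cox (k : nat) (x : X) := foldr s x (iota 1 k).

Lemma foldr_far i x r : all (fun j => (i.+1 < j) || (j.+1 < i)) r ->
  foldr s (s i x) r = s i (foldr s x r).
Proof.
elim: r => //= j r IH /andP[/orP[ij|ij] hr]; rewrite (IH hr); last by rewrite (s_far j i).
by rewrite (s_far i j).
Qed.

(** s_i passes the factors beyond i+1, the braid relation turns it into s_(i+1), and this passes the
    factors before i. *)
Lemma cox_conj k i x : 0 < i < k -> cox k (s i x) = s i.+1 (cox k x).
Proof.
move=> ik; rewrite /cox.
have -> : iota 1 k = iota 1 i.-1 ++ [:: i; i.+1] ++ iota i.+2 (k - i.+1).
  have -> : k = i.-1 + (2 + (k - i.+1)) by lia.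
  rewrite !iotaD /=; congr (_ ++ _); have -> : 1 + i.-1 = i by lia.
  by rewrite addnS addn1; congr [:: _, _ & iota _ _]; lia.
rewrite !foldr_cat /= (foldr_far i x); last by apply/allP => j; rewrite mem_iota /=; lia.
rewrite s_braid (foldr_far i.+1) //; apply/allP => j; rewrite mem_iota /=; lia.
Qed.

Lemma cox_conj_iter k i a x : 0 < i -> i + a <= k ->
  iter a (cox k) (s i x) = s (i + a) (iter a (cox k) x).
Proof.
move=> i0; elim: a => [|a IH] ia; first by rewrite addn0.
by rewrite /= IH ?cox_conj ?addnS //; lia.
Qed.

(* Moving the factors s_1, s_2, ..., s_k of the last cox k successively through
   the preceding powers gives (cox k)^(k+1) = (cox (k-1))^k. *)
Lemma cox_order k x : iter k.+1 (cox k) x = x.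
Proof.
elim: k x => // k IH x; rewrite -[RHS]IH.
suff H j y : j <= k.+1 -> iter k.+2 (cox k.+1) y =
    iter j (cox k) (iter (k.+1 - j) (cox k.+1) (foldr s y (iota j.+1 (k.+1 - j)))).
  by rewrite (H k.+1) // subnn.
elim: j => [|j IHj] jk; first by rewrite subn0 iterSr.
rewrite IHj 1?ltnW // iterSr; congr iter.
have -> : k.+1 - j = (k.+1 - j.+1).+1 by lia.
(* Passing all but one of the copies of [cox k.+1] turns the factor s_(j+1) into s_(k+1), which
   cancels the last factor of the remaining copy and leaves [cox k]. *)
rewrite [iota _ _]/= [foldr _ _ _]/= iterS cox_conj_iter; try lia.
have -> : j.+1 + (k.+1 - j.+1) = k.+1 by lia.
by rewrite {1}/cox -addn1 iotaD foldr_cat /= add1n addn1 sK.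
Qed.
End CoxeterElement.

(** * Reflections on tableaux *)

(** A prefix affects the matching of the later letters only through this number of unmatched letters
    i+1. *)
Fixpoint pending (i m : nat) (w : seq nat) : nat :=
  if w is x :: w' then
    pending i (if x == i.+1 then m.+1 else if x == i then m.-1 else m) w'
  else m.

Lemma reflect_from_cat i b m t u v : exists r t',
  reflect_from i b m t (u ++ v) = r ++ reflect_from i b (pending i m u) t' v /\
  size r = size u.
Proof.
elim: u m t => [|x u IH] m t /=; first by exists [::], t.
case: (x =P i.+1) => _; [|case: (x =P i) => _].
- by case: eqP => _; [have [r [t' [-> <-]]] := IH m.+1 t.+1 | have [r [t' [-> <-]]] := IH m.+1 t];
    eexists (_ :: r), t'.
- case: eqP => [->|_]; [have [r [t' [-> <-]]] := IH 0 t.+1 | have [r [t' [-> <-]]] := IH m.-1 t];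
    by eexists (_ :: r), t'.
- by have [r [t' [-> <-]]] := IH m t; exists (x :: r), t'.
Qed.

Lemma reflection_word_at i u x v (y := nth 0 (reflection_word i (u ++ x :: v)) (size u)) :
  [\/ y = x, [/\ x = i, y = i.+1 & pending i 0 u = 0]
    | [/\ x = i.+1, y = i & phi i v = 0]].
Proof.
rewrite {}/y reflection_wordE.
have [r [t [-> <-]]] := reflect_from_cat i (eps i (u ++ x :: v)) 0 0 u (x :: v).
rewrite nth_cat ltnn subnn /=.
case: (x =P i.+1) => [->|_]; [|case: (x =P i) => [->|_]; last by constructor 1].
- case: eqP => [p0|_] /=; last by constructor 1.
  by case: ifP => _; [constructor 3|constructor 1].
- case: eqP => [p0|_] /=; last by constructor 1.
  by case: ifP => _; [constructor 1|constructor 2].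
Qed.

(** Of two equal neighbours, an unmatched i is followed by an unmatched i, and an unmatched i+1 is
    preceded by an unmatched i+1. The new unmatched letters increase from left to right. *)
Lemma reflection_word_le i u x y v (w := reflection_word i (u ++ x :: y :: v)) :
  x <= y -> nth 0 w (size u) <= nth 0 w (size u).+1.
Proof.
move=> xy; rewrite {}/w reflection_wordE.
have [r [t [-> <-]]] := reflect_from_cat i (eps i (u ++ x :: y :: v)) 0 0 u (x :: y :: v).
rewrite !nth_cat ltnn ltnNge leqnSn subSnn subnn.
move: (eps i _) (pending _ _ _) => b m /=.
case: (x =P i.+1) => ?; [|case: (x =P i) => ?];
  (case: (y =P i.+1) => ?; [|case: (y =P i) => ?]); try lia;
  case: (phi i v =P 0) => ?; case: (m =P 0) => ? /=;
  decide_eqs; rewrite /=; do ?(case: ifP => ? /=); lia.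
Qed.

Lemma pending_ge i m (w : seq nat) : m + count_mem i.+1 w <= pending i m w + count_mem i w.
Proof.
elim: w m => [|x w IH] m /=; first lia.
set m' := (X in pending i X w); have := IH m'; rewrite {}/m'.
case: (x =P i.+1) => ?; [|case: (x =P i) => ?]; decide_eqs;
  by move: (pending _ _ _) (count_mem i w) (count_mem i.+1 w) => *; lia.
Qed.

Lemma pending_cat i m u v : pending i m (u ++ v) = pending i (pending i m u) v.
Proof. by elim: u m => /=. Qed.

(** In a sorted row no i follows an i+1, so no i+1 is matched within the row. *)
Lemma pending_sorted i m (w : seq nat) : sorted leq w -> count_mem i.+1 w <= pending i m w.
Proof.
elim: w m => [|x w IH] m //= pw.
have sw := path_sorted pw.
case: (x =P i.+1) => [xi|?]; last by rewrite add0n; apply: IH.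
have -> : count_mem i w = 0 -> 1 + count_mem i.+1 w <= pending i m.+1 w.
  by move=> c0; have := pending_ge i m.+1 w; lia.
by [].
apply/count_memPn/negP => iw.
by have := allP (order_path_min leq_trans pw) _ iw; lia.
Qed.

Lemma phi_ge i u v : phi i v <= phi i (u ++ v) + count_mem i.+1 u.
Proof.
elim: u => [|x u IH] /=; first lia.
move: IH; case: (x =P i.+1) => ?; [|case: (x =P i) => ?]; rewrite /=;
  by move: (phi i (u ++ v)) (phi i v) (count_mem _ u) => *; lia.
Qed.

(** As in [pending_sorted], the letters i of a sorted row are not matched by letters of the row. *)
Lemma phi_sorted i (u v : seq nat) : sorted leq u -> count_mem i u <= phi i (u ++ v).
Proof.
elim: u => [|x u IH] //= pu; have := IH (path_sorted pu).
case: (x =P i.+1) => [xi|?].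
2: by case: (x =P i) => ?; rewrite /=; move: (phi _ _) (count_mem _ _) => *; lia.
have -> : count_mem i u = 0; last by decide_eqs; lia.
apply/count_memPn/negP => iu.
by have := allP (order_path_min leq_trans pu) _ iu; lia.
Qed.

Lemma nth_shape (T : tableau) r : nth 0 (shape T) r = size (nth [::] T r).
Proof.
case: (ltnP r (size T)) => h; first by rewrite (nth_map [::]).
by rewrite !nth_default ?size_map.
Qed.

Lemma row_lt_size (T : tableau) i j : j < size (nth [::] T i) -> i < size T.
Proof. by rewrite ltnNge => h; rewrite ltnNge; apply: contra h => /(nth_default [::]) ->. Qed.

Lemma SSTP n la T : SST n la T <->
  [/\ shape T = la,
      forall i j, j < nth 0 la i -> 1 <= entry T i j <= n,
      forall i j, j.+1 < nth 0 la i -> entry T i j <= entry T i j.+1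
    & forall i j, j < nth 0 la i.+1 -> entry T i j < entry T i.+1 j].
Proof.
split=> - [sh h1 h2 h3]; split=> //.
- move=> i j; rewrite -sh nth_shape => hj.
  have iT := row_lt_size _ _ _ hj.
  exact: (allP (h1 _ (mem_nth [::] iT)) _ (mem_nth 0 hj)).
- move=> i j; rewrite -sh nth_shape => hj.
  have iT := row_lt_size _ _ _ hj.
  exact: (sortedP 0 (h2 _ (mem_nth [::] iT))).
- by move=> i j; rewrite -sh nth_shape; apply: h3.
- move=> row /(nthP [::])[i iT <-]; apply/allP => x /(nthP 0)[j hj <-].
  by apply: h1; rewrite -sh nth_shape.
- move=> row /(nthP [::])[i iT <-]; apply/(sortedP 0) => j hj.
  by apply: h2; rewrite -sh nth_shape.
- by move=> i j; rewrite -nth_shape sh; apply: h3.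
Qed.

Lemma size_reading_word T : size (reading_word T) = sumn (shape T).
Proof. by rewrite /reading_word size_flatten /shape map_rev sumn_rev. Qed.

Lemma shape_of_reading_word la w : size w = sumn la -> shape (of_reading_word la w) = la.
Proof.
by move=> sw; rewrite /of_reading_word /shape map_rev [map _ _]reshapeKl ?revK // sumn_rev sw.
Qed.

Lemma of_reading_wordK la w : size w = sumn la -> reading_word (of_reading_word la w) = w.
Proof. by move=> sw; rewrite /reading_word revK reshapeKr // sumn_rev sw. Qed.

Lemma reading_wordK T : of_reading_word (shape T) (reading_word T) = T.
Proof. by rewrite /of_reading_word /reading_word -map_rev flattenK revK. Qed.

Lemma reading_word_inj T T' : shape T = shape T' -> reading_word T = reading_word T' -> T = T'.
Proof. by move=> h1 h2; rewrite -(reading_wordK T) h1 h2 reading_wordK. Qed.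

Lemma shape_reflection i T : shape (reflection i T) = shape T.
Proof. by rewrite shape_of_reading_word // size_reflection_word size_reading_word. Qed.

Lemma reading_word_reflection i T :
  reading_word (reflection i T) = reflection_word i (reading_word T).
Proof. by rewrite of_reading_wordK // size_reflection_word size_reading_word. Qed.

Lemma reflectionK i : involutive (reflection i).
Proof.
move=> T; apply: reading_word_inj; rewrite ?shape_reflection //.
by rewrite !reading_word_reflection reflection_wordK.
Qed.

Lemma crystal_c_order n T : 0 < n -> iter n (crystal_c n) T = T.
Proof.
case: n => // n _; apply: cox_order => [|i j U ij|i U]; first exact: reflectionK.
- apply: reading_word_inj; rewrite ?shape_reflection //.
  by rewrite !reading_word_reflection reflection_word_far.
- apply: reading_word_inj; rewrite ?shape_reflection //.
  by rewrite !reading_word_reflection reflection_word_braid.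
Qed.

Lemma count_flatten_rev (p : pred nat) (T : tableau) :
  count p (reading_word T) = count p (flatten T).
Proof. by apply/seq.permP; rewrite /reading_word perm_flatten // perm_rev. Qed.

Lemma sumn_flatten_rev (T : tableau) : sumn (reading_word T) = sumn (flatten T).
Proof. by apply: perm_sumn; rewrite /reading_word perm_flatten // perm_rev. Qed.

Lemma count_reflection i T k : count_mem k (flatten (reflection i T)) =
  count_mem (if k == i then i.+1 else if k == i.+1 then i else k) (flatten T).
Proof. by rewrite -(count_flatten_rev _ T) -count_flatten_rev reading_word_reflection count_reflection_word. Qed.

Lemma sumn_reflection i T : sumn (flatten (reflection i T)) + count_mem i.+1 (flatten T) =
  sumn (flatten T) + count_mem i (flatten T).
Proof.
rewrite -!(count_flatten_rev _ T) -(sumn_flatten_rev T) -sumn_flatten_rev.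
by rewrite reading_word_reflection sumn_reflection_word.
Qed.

Lemma reading_word_split T r : r < size T -> reading_word T =
  reading_word (drop r.+1 T) ++ nth [::] T r ++ reading_word (take r T).
Proof.
move=> rT; rewrite -{1}(cat_take_drop r T) (drop_nth [::]) // /reading_word.
by rewrite rev_cat rev_cons -cats1 !flatten_cat /= cats0 -catA.
Qed.

Lemma entry_reading_word T r j : j < size (nth [::] T r) ->
  entry T r j = nth 0 (reading_word T) (sumn (drop r.+1 (shape T)) + j).
Proof.
move=> jr.
have rT := row_lt_size _ _ _ jr.
rewrite (reading_word_split _ _ rT) -map_drop -size_reading_word nth_cat ltnNge leq_addr /=.
by rewrite addKn nth_cat jr.
Qed.

Lemma leq_count_take (p q : pred nat) (a c : seq nat) j : j <= size c ->
  (forall k, k < j -> p (nth 0 a k) -> q (nth 0 c k)) -> count p (take j a) <= count q (take j c).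
Proof.
elim: j a c => [|j IH] [|x a] [|y c] //= jc h; rewrite ?take0 //.
by apply: leq_add; [have := h 0 isT; case: (p x) => //= -> | apply: IH => // k; apply: (h k.+1)].
Qed.

Lemma partition_nth_le la r : is_partition la -> nth 0 la r.+1 <= nth 0 la r.
Proof.
case=> sla _; case: (ltnP r.+1 (size la)) => h; last by rewrite nth_default.
by have /(sortedP 0)/(_ _ h) := sla.
Qed.

Lemma reading_word_at T r j (row := nth [::] T r) : j < size row ->
  reading_word T = (reading_word (drop r.+1 T) ++ take j row) ++
    entry T r j :: drop j.+1 row ++ reading_word (take r T) /\
  size (reading_word (drop r.+1 T) ++ take j row) = sumn (drop r.+1 (shape T)) + j.
Proof.
move=> jr; split; last first.
  by rewrite size_cat size_reading_word size_takel 1?ltnW // -map_drop.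
have rT := row_lt_size _ _ _ jr.
rewrite (reading_word_split _ _ rT) -catA; congr (_ ++ _).
by rewrite -cat_cons -drop_nth // catA cat_take_drop.
Qed.

(** Rows stay sorted by [reflection_word_le], and a column could only break at an i directly above
    an i+1. *)
Lemma SST_reflection n la i T : is_partition la -> 0 < i < n -> SST n la T ->
  SST n la (reflection i T).
Proof.
move=> pla iN hT; have [_ _ rows _] := hT.
have /SSTP [sh h1 h2 h3] := hT.
have szr r : size (nth [::] T r) = nth 0 la r by rewrite -sh nth_shape.
have E r j : j < nth 0 la r -> entry (reflection i T) r j =
    nth 0 (reflection_word i (reading_word T)) (sumn (drop r.+1 la) + j).
  move=> jr; rewrite entry_reading_word ?reading_word_reflection ?shape_reflection ?sh //.
  by rewrite -nth_shape shape_reflection sh.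
have at_ r j : j < nth 0 la r -> exists u v,
    [/\ reading_word T = u ++ entry T r j :: v, size u = sumn (drop r.+1 la) + j,
      u = reading_word (drop r.+1 T) ++ take j (nth [::] T r)
    & v = drop j.+1 (nth [::] T r) ++ reading_word (take r T)].
  by rewrite -szr -sh => /reading_word_at [? ?]; do 2 eexists; split; eauto.
have srow r : sorted leq (nth [::] T r).
  case: (ltnP r (size T)) => h; last by rewrite nth_default.
  exact/rows/mem_nth.
apply/SSTP; split; first by rewrite shape_reflection.
- move=> r j jr; rewrite E //; have [u [v [-> <- _ _]]] := at_ _ _ jr.
  have := h1 _ _ jr.
  by case: (reflection_word_at i u (entry T r j) v) => [->|[? -> _]|[? -> _]]; lia.
- move=> r j jr; rewrite (E _ _ jr) (E _ _ (ltnW jr)) addnS.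
  have [u [v [-> <- _ ->]]] := at_ _ _ (ltnW jr).
  rewrite (drop_nth 0) ?szr //; apply: reflection_word_le; exact: h2.
move=> r j jr; have jr' := leq_trans jr (partition_nth_le _ r pla).
have lt := h3 _ _ jr; rewrite !E //.
have [u [v [e1 <- eu _]]] := at_ _ _ jr'; have [u' [v' [e2 <- _ ev]]] := at_ _ _ jr.
have := reflection_word_at i u (entry T r j) v; rewrite -e1.
have := reflection_word_at i u' (entry T r.+1 j) v'; rewrite -e2.
have rT : r.+1 < size T by apply: (row_lt_size _ _ j); rewrite szr.
have mono q k l : k <= l -> l < nth 0 la q -> entry T q k <= entry T q l.
  move=> kl; elim: l kl => [|l IH]; first by rewrite leqn0 => /eqP->.
  rewrite leq_eqVlt => /orP[/eqP-> //|kl] lq.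
  exact: leq_trans (IH kl (ltnW lq)) (h2 _ _ lq).
(* a column pair i, i+1 is matched: it is bracketed within the two rows *)
have P1 : entry T r j = i -> entry T r.+1 j = i.+1 -> 0 < pending i 0 u.
  move=> a1 a2; rewrite eu (drop_nth [::]) // -cat1s /reading_word rev_cat flatten_cat.
  rewrite /= cats0 -catA !pending_cat.
  have := pending_sorted i (pending i 0 (flatten (rev (drop r.+2 T)))) _ (srow r.+1).
  set m := pending i _ (nth _ _ _); have := pending_ge i m (take j (nth [::] T r)).
  (* Left of column [j], an i in row [r] has an i+1 directly below it; the i+1 in column [j] is the
     surplus that is still pending. *)
  have := @leq_count_take (pred1 i) (pred1 i.+1) (nth [::] T r) (nth [::] T r.+1) j.
  rewrite szr => /(_ (ltnW jr)) L.
  have {}L : count_mem i (take j (nth [::] T r)) <= count_mem i.+1 (take j (nth [::] T r.+1)).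
    apply: L => k kj /= /eqP ak; apply/eqP.
    have := h3 r k (ltn_trans kj jr); have := mono r.+1 k j (ltnW kj) jr.
    by rewrite a2 /entry ak; lia.
  have := count_cat (pred1 i.+1) (take j (nth [::] T r.+1)) (drop j (nth [::] T r.+1)).
  rewrite cat_take_drop (drop_nth 0) ?szr // -[nth 0 _ j]/(entry _ _ _) a2 /= eqxx.
  by move: L; move: (pending _ _ _) (count_mem _ _) (count_mem _ _) (count_mem _ _) (count_mem _ _) => *; lia.
have P2 : entry T r j = i -> entry T r.+1 j = i.+1 -> 0 < phi i v'.
  move=> a1 a2; rewrite ev (take_nth [::] (ltnW rT)) /reading_word rev_rcons /=.
  have := phi_ge i (drop j.+1 (nth [::] T r.+1)) (nth [::] T r ++ flatten (rev (take r T))).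
  have := phi_sorted i _ (flatten (rev (take r T))) (srow r).
  rewrite -{1}(cat_take_drop j (nth [::] T r)) (drop_nth 0) ?szr //.
  rewrite -[nth 0 _ j]/(entry _ _ _) a1 count_cat /= eqxx.
  (* Right of column [j], an i+1 in row [r.+1] has an i directly above it; the i in column [j] is
     the surplus. *)
  have L : count_mem i.+1 (drop j.+1 (nth [::] T r.+1)) <= count_mem i (drop j.+1 (nth [::] T r)).
    rewrite -(take_size (drop j.+1 (nth [::] T r.+1))).
    apply: leq_trans (@leq_count_take _ (pred1 i) _ (drop j.+1 (nth [::] T r)) _ _ _) _.
    - by rewrite !size_drop !szr leq_sub2r // partition_nth_le.
    - move=> k; rewrite size_drop szr !nth_drop /= => kj /eqP ak; apply/eqP.
      have jk : j.+1 + k < nth 0 la r.+1 by lia.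
      have jk' := leq_trans jk (partition_nth_le _ r pla).
      have := h3 r _ jk; have := mono r j (j.+1 + k) _ jk'.
      by rewrite a1 /entry ak; lia.
    - by rewrite -{2}(cat_take_drop (size (drop j.+1 (nth [::] T r.+1))) (drop _ (nth _ _ r))) count_cat leq_addr.
  by move: L; move: (phi _ _) (phi _ _) (count_mem _ _) (count_mem _ _) (count_mem _ _) => *; lia.
(* An i that changes has no i+1 pending before it, and an i+1 that changes has no unmatched i after
   it; [P1] and [P2] exclude this for a vertical pair. *)
by case=> [->|[b1 -> b2]|[b1 -> b2]] [->|[a1 -> a2]|[a1 -> a2]]; try lia.
Qed.

(** * Promotion *)

Lemma entry_default T i j : size (nth [::] T i) <= j -> entry T i j = 0.
Proof. exact: nth_default. Qed.

Lemma entry_set_entry T i j x p q : entry (set_entry T i j x) p q =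
  if (p == i) && (q == j) then x else entry T p q.
Proof.
rewrite /entry /set_entry nth_set_nth /=.
case: (p =P i) => [->|] //=; by rewrite nth_set_nth /=; case: eqP.
Qed.

Lemma shape_set_entry T i j x : j < size (nth [::] T i) ->
  shape (set_entry T i j x) = shape T.
Proof.
move=> h; have iT := row_lt_size _ _ _ h.
apply: (@eq_from_nth _ 0); rewrite !size_map size_set_nth; first by apply/maxn_idPr.
move=> p _; rewrite !nth_shape nth_set_nth /=.
case: eqP => [->|//]; by rewrite size_set_nth; apply/maxn_idPr.
Qed.

Lemma sumn_flatten_shape (T : tableau) : sumn (flatten T) = sumn [seq sumn r | r <- T].
Proof. by elim: T => //= r T IH; rewrite sumn_cat IH. Qed.

Lemma sumn_set_entry T i j x : j < size (nth [::] T i) ->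
  sumn (flatten (set_entry T i j x)) + entry T i j = sumn (flatten T) + x.
Proof.
move=> h; have iT := row_lt_size _ _ _ h.
have sle (s : seq nat) l : nth 0 s l <= sumn s.
  by elim: s l => [|y s IH] [|l] //=; rewrite ?leq_addr // (leq_trans (IH l)) // leq_addl.
rewrite /set_entry !sumn_flatten_shape.
have -> (r : seq nat) : [seq sumn r | r <- set_nth [::] T i r] = set_nth 0 [seq sumn r | r <- T] i (sumn r).
  apply: (@eq_from_nth _ 0); first by rewrite size_map !size_set_nth size_map.
  rewrite size_map size_set_nth => p hp; rewrite (nth_map [::]) ?size_set_nth // !nth_set_nth /=.
  case: eqP => // pi; rewrite (nth_map [::]) //; move: hp; lia.
rewrite sumn_set_nth0 sumn_set_nth0 (nth_map [::]) //.
have := sle (nth [::] T i) j; have := sle [seq sumn r | r <- T] i; rewrite (nth_map [::]) //.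
by rewrite /entry; move: (nth 0 _ j) (sumn _) (sumn _) => *; lia.
Qed.

Lemma tableau_ext (T T' : tableau) : shape T = shape T' ->
  (forall i j, j < nth 0 (shape T) i -> entry T i j = entry T' i j) -> T = T'.
Proof.
move=> sh h; apply: (@eq_from_nth _ [::]).
  by have := congr1 size sh; rewrite !size_map.
move=> i iT; apply: (@eq_from_nth _ 0); first by rewrite -!nth_shape sh.
by move=> j jT; apply: h; rewrite nth_shape.
Qed.

Section Promotion.
Variables (n : nat) (la : seq nat).
Hypotheses (n_gt0 : 0 < n) (pla : is_partition la).

Notation cell i j := (j < nth 0 la i).

Let cell_up i j : cell i.+1 j -> cell i j.
Proof. by move=> h; apply: leq_trans h (partition_nth_le _ _ pla). Qed.

Lemma entry_out T i j : shape T = la -> ~ cell i j -> entry T i j = 0.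
Proof. by move=> <- h; apply: entry_default; rewrite -nth_shape leqNgt; apply/negP. Qed.

(* The state between two slides: k dots have reached their final place, and the
   dots that have not moved yet still carry the entry n. *)
Record filled (k : nat) (T : tableau) : Prop := Filled {
  filled_shape : shape T = la;
  filled_top : k <= nth 0 la 0;
  filled_le : forall p q, cell p q -> entry T p q <= n;
  filled_zero : forall p q, cell p q -> (entry T p q == 0) = (p == 0) && (q < k);
  filled_row : forall p q, cell p q.+1 -> entry T p q <= entry T p q.+1;
  filled_col : forall p q, cell p.+1 q -> entry T p q < entry T p.+1 q }.

(* [B p - 1] is the column in which the previous dot left row p upwards: the
   moving dot stays strictly to the right of it. *)
Record barrier (k : nat) (B : nat -> nat) (T : tableau) (i : nat) : Prop := Barrier {
  barrier_ge : forall p, 0 < p <= i -> k <= B p;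
  barrier_mono : forall p q, 0 < p <= q -> q <= i -> B p <= B q;
  barrier_le : forall p b, p < i -> B p.+1 = b.+1 -> cell p b.+1 ->
     entry T p.+1 b <= entry T p b.+1 }.

(** The state during a slide: the order relations hold away from the dot and across it. By
    [holed_lt] no waiting dot, still an entry n, lies northwest of the moving one. *)
Record holed (k : nat) (B : nat -> nat) (T : tableau) (i j : nat) : Prop := Holed {
  holed_shape : shape T = la;
  holed_cell : cell i j;
  holed_dot : entry T i j = 0;
  holed_le : forall p q, cell p q -> entry T p q <= n;
  holed_zero : forall p q, cell p q -> ~ (p = i /\ q = j) ->
    (entry T p q == 0) = (p == 0) && (q < k);
  holed_row : forall p q, cell p q.+1 -> ~ (p = i /\ (q = j \/ q.+1 = j)) ->
    entry T p q <= entry T p q.+1;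
  holed_col : forall p q, cell p.+1 q -> ~ (q = j /\ (p = i \/ p.+1 = i)) ->
    entry T p q < entry T p.+1 q;
  holed_skip_row : forall q, j = q.+1 -> cell i q.+2 -> entry T i q <= entry T i q.+2;
  holed_skip_col : forall p, i = p.+1 -> cell p.+2 j -> entry T p j < entry T p.+2 j;
  holed_lt : forall p q, p <= i -> q <= j -> entry T p q < n;
  holed_top : i = 0 -> k <= j;
  holed_barrier : barrier k B T i;
  holed_right : 0 < i -> B i <= j }.

Definition move_dot (T : tableau) (i j i' j' : nat) : tableau :=
  set_entry (set_entry T i j (entry T i' j')) i' j' 0.

Lemma shape_move_dot T i j i' j' : shape T = la -> cell i j -> cell i' j' ->
  shape (move_dot T i j i' j') = la.
Proof.
move=> sh c c'; have e := shape_set_entry T i j (entry T i' j').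
by rewrite /move_dot shape_set_entry ?e // -nth_shape ?e -?nth_shape sh.
Qed.

Lemma entry_move_dot T i j i' j' p q : entry (move_dot T i j i' j') p q =
  if (p == i') && (q == j') then 0 else
  if (p == i) && (q == j) then entry T i' j' else entry T p q.
Proof. by rewrite /move_dot !entry_set_entry. Qed.

Lemma sumn_move_dot T i j i' j' : shape T = la -> cell i j -> cell i' j' ->
  entry T i j = 0 -> ~ (i = i' /\ j = j') ->
  sumn (flatten (move_dot T i j i' j')) = sumn (flatten T).
Proof.
move=> sh c c' e ne; have := @sumn_set_entry T i j (entry T i' j').
rewrite -nth_shape sh e => /(_ c) h1.
have := @sumn_set_entry (set_entry T i j (entry T i' j')) i' j' 0.
rewrite -nth_shape shape_set_entry -?nth_shape ?sh // => /(_ c').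
rewrite -/(move_dot T i j i' j') entry_set_entry; case: andP => [[/eqP ? /eqP ?]|_]; first by case: ne.
lia.
Qed.

Ltac split_eqs := repeat match goal with
  | |- context [if (?a == ?b) && _ then _ else _] =>
     case: (a =P b) => ?; rewrite ?andbF /=
  | |- context [if ?a == ?b then _ else _] => case: (a =P b) => ?; rewrite ?andbF ?andbT /=
  end.

Lemma holed_up k B T i j : holed k B T i.+1 j -> left_of T i.+1 j <= entry T i j ->
  holed k B (move_dot T i.+1 j i j) i j.
Proof.
case=> sh ce dot le zero row col srow scol lt top [bge bm ble] right hl.
have ce' := cell_up _ _ ce.
split; rewrite ?shape_move_dot //.
- by rewrite entry_move_dot !eqxx.
- by move=> p q c; rewrite entry_move_dot; split_eqs => //; first [exact: (le _ _ ce') | exact: (le _ _ c)].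
- have := bge i.+1; have := right => h1 h2.
  move=> p q c nd; rewrite entry_move_dot; split_eqs; try lia; try (by apply: zero => //; lia).
  by rewrite zero //; lia.
- move=> p q c nd; rewrite !entry_move_dot.
  case: (p =P i.+1) => ?.
    subst p; have -> : (i.+1 == i) = false by lia.
    rewrite /=; case: (q =P j) => ?.
      subst q; have -> : (j.+1 == j) = false by lia.
      by have := row i j (cell_up _ _ c); have := col i j.+1 c; lia.
    case: (q.+1 =P j) => ?; first by subst j.
    by apply: row => //; lia.
  rewrite /=; split_eqs; try lia; by apply: row => //; lia.
- move=> p q c nd; rewrite !entry_move_dot.
  case: (q =P j) => ?; rewrite ?andbF ?andbT; last by apply: col => //; lia.
  subst q; case: (p =P i.+1) => ?.
    by subst p; decide_eqs; apply: scol.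
  by decide_eqs; apply: col => //; lia.
- move=> q jq c; rewrite !entry_move_dot; decide_eqs; subst j.
  by have := row i q ce'; have := row i q.+1 c; lia.
- move=> p ip c; rewrite !entry_move_dot; decide_eqs; subst i.
  by apply: col => //; lia.
- by move=> p q pi qj; rewrite entry_move_dot; split_eqs => //; apply: lt; lia.
- by move=> i0; have := bge i.+1; have := right; lia.
- split; [by move=> p hp; apply: bge; lia | by move=> p q hp hq; apply: bm; lia |].
  move=> p b pi eb c; rewrite !entry_move_dot.
  have := bm p.+1 i.+1; have := right => h1 h2.
  have -> : (b == j) = false by lia.
  by rewrite !andbF; decide_eqs; apply: ble => //; lia.
- by move=> i0; have := bm i i.+1; have := right; lia.
Qed.

Lemma holed_left k B T i j : holed k B T i j.+1 -> above T i j.+1 < entry T i j ->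
  holed k B (move_dot T i j.+1 i j) i j.
Proof.
case=> sh ce dot le zero row col srow scol lt top [bge bm ble] right hl.
have ce' : cell i j := ltnW ce.
(* If the previous dot left row [i] in column [j], then [barrier_le] makes the left entry at most
   the upper one, and the dot would move up instead. *)
have Bj : 0 < i -> B i <= j.
  move=> i0; have := right i0; rewrite leq_eqVlt => /orP[/eqP Bi|//].
  case: i i0 Bi ce ble hl {sh dot le zero row col srow scol lt top bge bm right ce'} => // i _ Bi ce ble /=.
  by have := ble i j (ltnSn _) Bi (cell_up _ _ ce); lia.
split; rewrite ?shape_move_dot //.
- by rewrite entry_move_dot !eqxx.
- by move=> p q c; rewrite entry_move_dot; split_eqs => //; first [exact: (le _ _ ce') | exact: (le _ _ c)].
- move=> p q c nd; rewrite entry_move_dot; split_eqs; try lia; try (by apply: zero => //; lia).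
- move=> p q c nd; rewrite !entry_move_dot.
  case: (p =P i) => ? /=; last by apply: row => //; lia.
  subst p; case: (q =P j.+1) => ?.
    by subst q; decide_eqs; apply: srow.
  by decide_eqs; apply: row => //; lia.
- move=> p q c nd; rewrite !entry_move_dot.
  case: (q =P j.+1) => ?.
    subst q; have -> : (j.+1 == j) = false by lia.
    rewrite !andbF !andbT.
    case: (p =P i) => ?.
      subst p; have -> : (i.+1 == i) = false by lia.
      by have := col i j (ltnW c); have := row i.+1 j c; lia.
    case: (p.+1 =P i) => ?; first by subst i.
    by apply: col => //; lia.
  rewrite !andbF; split_eqs; try lia; by apply: col => //; lia.
- move=> q jq c; rewrite !entry_move_dot; decide_eqs; subst j.
  by apply: row => //; lia.
- move=> p ip c; rewrite !entry_move_dot; decide_eqs; subst i.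
  by have := col p j ce'; have := col p.+1 j c; lia.
- by move=> p q pi qj; rewrite entry_move_dot; split_eqs => //; apply: lt; lia.
- move=> i0; subst i; have := top erefl; rewrite leq_eqVlt => /orP[/eqP kj|//].
  by have := zero 0 j ce'; rewrite /= in hl; lia.
- split=> // p b pi eb c; rewrite !entry_move_dot.
  have := bm p.+1 i; have := Bj => h1 h2.
  have -> : (b == j) = false by lia.
  by decide_eqs; rewrite !andbF; apply: ble.
Qed.

(** * Slides as runs of a reversible step *)

Definition state := (tableau * (nat * nat))%type.

(** A dot that has arrived stays put, so surplus steps are harmless. *)
Definition step (s : state) : state :=
  let: (T, (i, j)) := s in
  if (above T i j == 0) && (left_of T i j == 0) then s
  else if left_of T i j <= above T i j then
    (set_entry (set_entry T i j (above T i j)) i.-1 j 0, (i.-1, j))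
  else (set_entry (set_entry T i j (left_of T i j)) i j.-1 0, (i, j.-1)).

Lemma slide_iter f T i j : slide f T i j = (iter f step (T, (i, j))).1.
Proof.
elim: f T i j => //= f IH T i j; rewrite -iterS iterSr {2}/step.
case E : (_ && _); last by case: ifP => _.
by rewrite iter_fix // /step E.
Qed.

Arguments step : simpl never.

Definition valid k (s : state) := exists B, holed k B s.1 s.2.1 s.2.2.

(** The number of moves left, since the dot ends at (0, k). *)
Definition rank k (s : state) := s.2.1 + s.2.2 - k.

Lemma holed_rank k B T i j : holed k B T i j -> k <= j.
Proof.
move=> h; have [i0|i0] := posnP i; first exact: (holed_top _ _ _ _ _ h).
have [bge _ _] := holed_barrier _ _ _ _ _ h.
by apply: leq_trans (bge i _) (holed_right _ _ _ _ _ h i0); rewrite i0 /=.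
Qed.

Variant step_spec k B T i j : state -> Prop :=
| StepStop of i = 0 & j = k : step_spec k B T i j (T, (i, j))
| StepUp i' of i = i'.+1 & left_of T i j <= entry T i' j
    & holed k B (move_dot T i j i' j) i' j :
    step_spec k B T i j (move_dot T i j i' j, (i', j))
| StepLeft j' of j = j'.+1 & above T i j < entry T i j' & k < i + j
    & holed k B (move_dot T i j i j') i j' :
    step_spec k B T i j (move_dot T i j i j', (i, j')).

Lemma stepP k B T i j : holed k B T i j -> step_spec k B T i j (step (T, (i, j))).
Proof.
move=> h; have kj := holed_rank _ _ _ _ _ h; rewrite /step.
have zero := holed_zero _ _ _ _ _ h.
have ce := holed_cell _ _ _ _ _ h.
case: i h zero ce => [|i] h zero ce /=.
  case: j h zero ce kj => [|j] h zero ce kj /=; first by apply: StepStop; lia.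
  have z : (entry T 0 j == 0) = (j < k) by rewrite zero //; [exact: ltnW | lia].
  case: (ltnP j k) z => jk z; rewrite z; first by apply: StepStop; lia.
  have e0 : 0 < entry T 0 j by rewrite lt0n z.
  rewrite leqNgt e0 /=; apply: StepLeft => //; exact: holed_left.
(* The finished dots lie left of column [k] in row 0 and [k <= j], so a dot below row 0 always has a
   nonzero entry above it. *)
have z : (entry T i j == 0) = false by rewrite zero ?(cell_up _ _ ce) //; lia.
rewrite {}z /=.
case: (leqP _ _) => hl; first by apply: StepUp => //; apply: holed_up.
case: j h zero ce kj hl => [|j] h zero ce kj hl //=.
by apply: StepLeft => //; try exact: holed_left; lia.
Qed.

Lemma step_stop k B T : holed k B T 0 k -> step (T, (0, k)) = (T, (0, k)).
Proof. by move=> h; case: (stepP _ _ _ _ _ h) => // j'; lia. Qed.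

Lemma step_valid k s : valid k s -> 0 < rank k s ->
  valid k (step s) /\ rank k s = (rank k (step s)).+1.
Proof.
case: s => T [i j] [B /= h]; rewrite /rank /=; have kj := holed_rank _ _ _ _ _ h.
case: (stepP _ _ _ _ _ h) => /=.
- by move=> -> ->; lia.
- by move=> i' -> _ h' _; split; [exists B | have := holed_rank _ _ _ _ _ h'; lia].
- by move=> j' -> _ _ h' _; split; [exists B | have := holed_rank _ _ _ _ _ h'; lia].
Qed.

(** After a move up there is a box below the dot; after a move left the exchanged entry, less than
    n, stands on its right. Hence no move ends in an [initial] position. *)
Lemma step_next k s : valid k s -> 0 < rank k s ->
  let: (T, (i, j)) := step s in cell i.+1 j \/ cell i j.+1 /\ entry T i j.+1 < n.
Proof.
case: s => T [i j] [B /= h]; rewrite /rank /=; have kj := holed_rank _ _ _ _ _ h.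
have ce := holed_cell _ _ _ _ _ h.
case: (stepP _ _ _ _ _ h) => /=.
- by move=> -> ->; lia.
- by move=> i' e _ _ _; left; rewrite -e.
- move=> j' e _ _ _ _; right; rewrite -e; split=> //.
  rewrite entry_move_dot !eqxx /=; have -> : (j == j') = false by lia.
  by apply: (holed_lt _ _ _ _ _ h); lia.
Qed.

(** A move can be undone once its direction is known, and the entries below and to the right of the
    dot reveal the direction. *)
Lemma step_inj k s s' : valid k s -> valid k s' -> 0 < rank k s -> 0 < rank k s' ->
  step s = step s' -> s = s'.
Proof.
case: s => T [i j] [B /= h]; case: s' => T' [i' j'] [B' /= h'].
rewrite /rank /= => r r'; have kj := holed_rank _ _ _ _ _ h; have kj' := holed_rank _ _ _ _ _ h'.
have sh := holed_shape _ _ _ _ _ h; have sh' := holed_shape _ _ _ _ _ h'.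
have ce := holed_cell _ _ _ _ _ h; have ce' := holed_cell _ _ _ _ _ h'.
have dot := holed_dot _ _ _ _ _ h; have dot' := holed_dot _ _ _ _ _ h'.
have ext p q : (forall a b, entry (move_dot T i j p q) a b = entry (move_dot T' i j p q) a b) ->
    entry T' i j = 0 -> ~ (i = p /\ j = q) -> T = T'.
  move=> E d' ne; apply: tableau_ext; first by rewrite sh.
  move=> a b _; have := E a b; have := E i j; rewrite !entry_move_dot !eqxx /=.
  have -> : (i == p) && (j == q) = false by lia.
  case: (a =P i) => [->|_]; case: (b =P j) => [->|_] //=; rewrite ?dot ?d' //;
  by case: andP => [[/eqP -> /eqP ->]|].
(* the dot moved up iff the entry now below it is at most the one to its right *)
have absurd T1 T2 a b B1 B2 : holed k B1 T1 a.+1 b -> holed k B2 T2 a b.+1 ->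
    move_dot T1 a.+1 b a b = move_dot T2 a b.+1 a b -> False.
  move=> h1 h2 E.
  have := congr1 (fun U => entry U a.+1 b) E; have := congr1 (fun U => entry U a b.+1) E.
  rewrite !entry_move_dot; decide_eqs => e1 e2.
  have c1 := holed_cell _ _ _ _ _ h1; have c2 := holed_cell _ _ _ _ _ h2.
  have := holed_row _ _ _ _ _ h1 a b c2; have := holed_col _ _ _ _ _ h2 a b c1.
  lia.
case: (stepP _ _ _ _ _ h) => [||]; first by lia.
- move=> p ei _ _; subst i; case: (stepP _ _ _ _ _ h'); first by lia.
  + move=> p' ei' _ _ [E ep ej]; subst i' p' j'.
    by rewrite (ext p j) // => [a b|]; [rewrite E | lia].
  + move=> q ej' _ _ _ [E ep ej]; subst; by case: (absurd _ _ _ _ _ _ h h' E).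
- move=> q ej _ _ _; subst j; case: (stepP _ _ _ _ _ h'); first by lia.
  + move=> p' ei' _ _ [E ep ej]; subst; by case: (absurd _ _ _ _ _ _ h' h (esym E)).
  + move=> q' ej' _ _ _ [E ep ej]; subst i' q' j'.
    by rewrite (ext i q) // => [a b|]; [rewrite E | lia].
Qed.

Lemma iter_valid k s m : valid k s -> m <= rank k s ->
  valid k (iter m step s) /\ rank k (iter m step s) = rank k s - m.
Proof.
move=> v; elim: m => [|m IH] hm; first by rewrite subn0.
have [v' r'] := IH (ltnW hm); have [|v'' r''] := step_valid _ _ v'; first lia.
by rewrite iterS; split=> //; lia.
Qed.

Lemma iter_inj k s s' m : valid k s -> valid k s' -> m <= rank k s -> m <= rank k s' ->
  iter m step s = iter m step s' -> s = s'.
Proof.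
move=> v v'; elim: m => //= m IH hm hm' e; apply: IH; try exact: ltnW.
have [? ?] := iter_valid _ _ _ v (ltnW hm); have [? ?] := iter_valid _ _ _ v' (ltnW hm').
by apply: (@step_inj k) => //; lia.
Qed.

Definition initial (s : state) := let: (T, (i, j)) := s in
  ~ (cell i.+1 j \/ cell i j.+1 /\ entry T i j.+1 < n).

(** If the run from [s'] is longer, tracing both runs back makes [s] the result of a move, which an
    initial position cannot be. *)
Lemma iter_rank_inj k s s' : valid k s -> valid k s' -> initial s -> rank k s <= rank k s' ->
  iter (rank k s) step s = iter (rank k s') step s' -> s = s'.
Proof.
move=> v v' st r e; move: (r); rewrite leq_eqVlt => /orP[/eqP rr|lt].
  by apply: (iter_inj _ _ _ _ v v' (leqnn _)); rewrite ?e ?rr.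
case: (posnP (rank k s' - rank k s)) => [|d0]; first lia.
have [v1 r1] := iter_valid _ _ (rank k s' - rank k s).-1 v' ltac:(lia).
have [|v2 r2] := step_valid _ _ v1; first lia.
have := step_next _ _ v1; case E : (step _) => [T [i j]] /(_ ltac:(lia)) bad.
have es : s = (T, (i, j)); last by rewrite es in st.
rewrite -E in v2 r2 *.
apply: (iter_inj _ _ _ (rank k s) v v2) => //; first lia.
by rewrite e -iterS -iterD; congr iter; lia.
Qed.

Lemma slide_spec k B T i j : holed k B T i j -> exists U B',
  [/\ iter (i + j - k) step (T, (i, j)) = (U, (0, k)) /\ holed k B U 0 k,
      sumn (flatten U) = sumn (flatten T),
      forall p q, ~ (p <= i /\ q <= j) -> entry U p q = entry T p q,
      forall p q, p <= i -> q <= j -> entry U p q < n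
    & barrier k.+1 B' U i /\ (0 < i -> B' i <= j.+1)].
Proof.
move: {2}(i + j - k) (erefl (i + j - k)) => m.
elim: m T i j => [|m IH] T i j hm h; have kj := holed_rank _ _ _ _ _ h.
  have [ei ej] : i = 0 /\ j = k by lia.
  subst i j; exists T, (fun=> 0); split=> //.
  - by rewrite add0n subnn.
  - by move=> p q pi qj; apply: (holed_lt _ _ _ _ _ h).
  - by split=> //; split=> p; lia.
have sh := holed_shape _ _ _ _ _ h; have ce := holed_cell _ _ _ _ _ h.
have dot := holed_dot _ _ _ _ _ h; have lt := holed_lt _ _ _ _ _ h.
rewrite hm iterSr; case: (stepP _ _ _ _ _ h); first lia.
- move=> i' ei hl h'; subst i.
  have hm' : i' + j - k = m by lia.
  have [U [B' [[e1 e2] e3 e4 e5 [[bge bm ble] e6]]]] := IH _ _ _ hm' h'.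
  exists U, (fun p => if p == i'.+1 then j.+1 else B' p); split.
  + by rewrite -hm' e1.
  + by rewrite e3 sumn_move_dot // ?(cell_up _ _ ce) //; lia.
  + by move=> p q pq; rewrite e4 ?entry_move_dot; [decide_eqs; split_eqs; try lia| lia].
  + move=> p q; rewrite leq_eqVlt => /orP[/eqP->|pi] qj; last exact: e5.
    by rewrite e4 ?entry_move_dot; [decide_eqs; split_eqs; apply: lt; lia | lia].
  + split; last by rewrite eqxx.
    split.
    * by move=> p hp; case: eqP => ?; [lia | apply: bge; lia].
    * move=> p q hp hq; case: (q =P i'.+1) => ?; case: (p =P i'.+1) => ?; try lia.
        by have := bm p i'; have := e6; lia.
      by apply: bm; lia.
    (* The entry on the path in row [i'.+1] has come down from row [i'], where it was the left
       neighbour of the entry it is compared with. *)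
    * move=> p b hp; case: eqP => [[->] [<-]|ne] c; last by move=> hb; apply: ble => //; lia.
      rewrite !e4 ?entry_move_dot; try lia; decide_eqs.
      by apply: (holed_row _ _ _ _ _ h) => //; lia.
- move=> j' ej hl _ h'; subst j.
  have hm' : i + j' - k = m by lia.
  have [U [B' [[e1 e2] e3 e4 e5 [e7 e6]]]] := IH _ _ _ hm' h'.
  exists U, B'; split.
  + by rewrite -hm' e1.
  + by rewrite e3 sumn_move_dot // 1?ltnW //; lia.
  + by move=> p q pq; rewrite e4 ?entry_move_dot; [split_eqs; lia| lia].
  + move=> p q pi; rewrite leq_eqVlt => /orP[/eqP->|qj]; last exact: e5.
    by rewrite e4 ?entry_move_dot; [decide_eqs; split_eqs; apply: lt; lia | lia].
  + by split=> // i0; have := e6 i0; lia.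
Qed.

(** * The dots one after the other *)

Lemma filled_holed k T B i j : filled k T -> cell i j -> entry T i j = n ->
  (forall p q, entry T p q = n -> p <= i -> q <= j -> p = i /\ q = j) ->
  barrier k B T i -> (0 < i -> B i <= j) -> holed k B (set_entry T i j 0) i j.
Proof.
case=> sh ktop le zero row col ce en first [bge bm ble] right.
split; rewrite ?shape_set_entry -?nth_shape ?sh //.
- by rewrite entry_set_entry !eqxx.
- by move=> p q c; rewrite entry_set_entry; case: ifP => // _; apply: le.
- move=> p q c ne; rewrite entry_set_entry; split_eqs; try lia; exact: zero.
- move=> p q c ne; rewrite !entry_set_entry; split_eqs; try lia; exact: row.
- move=> p q c ne; rewrite !entry_set_entry; split_eqs; try lia; exact: col.
- move=> q e c; subst j; rewrite !entry_set_entry; decide_eqs.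
  by have := row i q ce; have := row i q.+1 c; lia.
- move=> p e c; subst i; rewrite !entry_set_entry; decide_eqs.
  by have := col p j ce; have := col p.+1 j c; lia.
- move=> p q pi qj; rewrite entry_set_entry; case: ifP => // ne.
  have : entry T p q <= n.
    by case: (ltnP q (nth 0 la p)) => c; [apply: le | rewrite entry_out //; lia].
  by rewrite leq_eqVlt => /orP[/eqP e|//]; have := first _ _ e pi qj; lia.
- by move=> i0; subst i; have := zero 0 j ce; rewrite en /=; lia.
- split=> // p b pi eb c; rewrite !entry_set_entry.
  have -> : (p == i) = false by lia.
  case: (p.+1 =P i) => [pe|_] /=; last exact: ble.
  have -> : (b == j) = false by subst i; have := right; lia.
  exact: ble.
Qed.

Lemma holed_filled k B T : holed k B T 0 k -> filled k.+1 T.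
Proof.
case=> sh ce dot le zero row col srow scol lt top _ _; split=> //.
- move=> p q c; case: (p =P 0) => [p0|p0]; last by rewrite zero //; lia.
  by case: (q =P k) => [qk|qk]; [subst; rewrite dot; lia | rewrite zero //; lia].
- move=> p q c; case: (p =P 0) => [p0|p0]; last by apply: row => //; lia.
  subst p; case: (q =P k) => [->|qk]; first by rewrite dot.
  case: (q.+1 =P k) => [e|qk']; last by apply: row => //; lia.
  by have := zero 0 q (ltnW c); rewrite e dot; lia.
- move=> p q c; case: (q =P k) => [qk|qk]; last by apply: col => //; lia.
  subst q; case: (p =P 0) => [p0|p0]; last by apply: col => //; lia.
  by subst p; have := zero 1 k c; rewrite dot; lia.
Qed.

(** Only the dot about to move becomes 0; the others remain entries n until their turn. *)
Definition slide_dot (T : tableau) (d : nat * nat) : tableau :=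
  slide (d.1 + d.2) (set_entry T d.1 d.2 0) d.1 d.2.

(** The boxes with entry n form a horizontal strip, listed from left to right. *)
Definition strip (d d' : nat * nat) := (d.2 < d'.2) && (d'.1 <= d.1).

Record ready (k : nat) (T : tableau) (ds : seq (nat * nat)) : Prop := Ready {
  ready_filled : filled k T;
  ready_dots : forall p q, ((p, q) \in ds) = (entry T p q == n);
  ready_strip : pairwise strip ds;
  ready_barrier : forall d ds', ds = d :: ds' ->
    exists B, barrier k B T d.1 /\ (0 < d.1 -> B d.1 <= d.2) }.

Lemma ready_holed k T i j ds : ready k T ((i, j) :: ds) ->
  [/\ cell i j, entry T i j = n, initial (set_entry T i j 0, (i, j))
    & exists B, holed k B (set_entry T i j 0) i j].
Proof.
case=> fT mem st bar; have sh := filled_shape _ _ fT.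
have en : entry T i j = n by apply/eqP; rewrite -mem mem_head.
have ce : cell i j.
  by case: (ltnP j (nth 0 la i)) => // c; move: en; rewrite entry_out //; lia.
split=> //.
  rewrite /initial entry_set_entry; decide_eqs; case=> [c|[c]].
    by have := filled_col _ _ fT i j c; have := filled_le _ _ fT _ _ c; lia.
  by have := filled_row _ _ fT i j c; lia.
have [B [b1 b2]] := bar _ _ erefl; exists B; apply: filled_holed => // p q.
move=> /eqP; rewrite -mem inE => /orP[/eqP[-> ->] //|pq] pi qj.
by have /andP[/allP/(_ _ pq) /andP[/=]] := st; lia.
Qed.

Lemma slide_dotE k B T i j U : holed k B (set_entry T i j 0) i j -> holed k B U 0 k ->
  iter (i + j - k) step (set_entry T i j 0, (i, j)) = (U, (0, k)) -> slide_dot T (i, j) = U.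
Proof.
move=> h hU e; have kj := holed_rank _ _ _ _ _ h; rewrite /slide_dot slide_iter /=.
have -> : i + j = k + (i + j - k) by lia.
by rewrite iterD e iter_fix //; apply: step_stop hU.
Qed.

Lemma barrier_sub k B T i i' : i' <= i -> barrier k B T i -> barrier k B T i'.
Proof.
move=> ii [bge bm ble]; split.
- by move=> p hp; apply: bge; lia.
- by move=> p q hp hq; apply: bm; lia.
- by move=> p b hp; apply: ble; lia.
Qed.

Lemma ready_step k T d ds : ready k T (d :: ds) ->
  ready k.+1 (slide_dot T d) ds /\
  sumn (flatten (slide_dot T d)) + n = sumn (flatten T).
Proof.
case: d => i j rT; have [ce en _ [B h]] := ready_holed _ _ _ _ _ rT.
have [U [B' [[e1 e2] e3 e4 e5 [e6 e7]]]] := slide_spec _ _ _ _ _ h.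
case: rT => fT mem st bar; have sh := filled_shape _ _ fT.
rewrite (slide_dotE _ _ _ _ _ _ h e2 e1); split; last first.
  by rewrite e3 -en sumn_set_entry ?addn0 // -nth_shape sh.
have st' p q : (p, q) \in ds -> j < q /\ p <= i.
  by move=> pq; have /andP[/allP/(_ _ pq) /andP[/=]] := st.
split; first exact: holed_filled e2.
- move=> p q; case: (boolP ((p <= i) && (q <= j))) => reg.
    have -> : ((p, q) \in ds) = false by apply/negbTE/negP => /st'; lia.
    by have := e5 p q; lia.
  rewrite e4 ?entry_set_entry; last lia.
  have -> : (p == i) && (q == j) = false by lia.
  by rewrite -mem inE xpair_eqE; have -> : (p == i) && (q == j) = false by lia.
- by have /andP[] := st.
- move=> [p q] ds' e; have [|q' p'] := st' p q; first by rewrite e mem_head.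
  exists B'; split; first exact: barrier_sub e6.
  by move=> /= p0; have := barrier_mono _ _ _ _ e6 p i; lia.
Qed.

(** Both slides end at (0, k) and can be traced back from there; the starting box is recognized as
    an [initial] position. *)
Lemma slide_dot_inj k T T' d d' ds ds' : ready k T (d :: ds) -> ready k T' (d' :: ds') ->
  slide_dot T d = slide_dot T' d' -> T = T'.
Proof.
case: d d' => i j [i' j'] rT rT'.
have [ce en ini [B h]] := ready_holed _ _ _ _ _ rT.
have [ce' en' ini' [B' h']] := ready_holed _ _ _ _ _ rT'.
have [U [_ [[e1 e2] _ _ _ _]]] := slide_spec _ _ _ _ _ h.
have [U' [_ [[e1' e2'] _ _ _ _]]] := slide_spec _ _ _ _ _ h'.
rewrite (slide_dotE _ _ _ _ _ _ h e2 e1) (slide_dotE _ _ _ _ _ _ h' e2' e1') => eU.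
have sh := filled_shape _ _ (ready_filled _ _ _ rT).
have sh' := filled_shape _ _ (ready_filled _ _ _ rT').
suff [e ei ej] : (set_entry T i j 0, (i, j)) = (set_entry T' i' j' 0, (i', j')).
  subst i' j'; apply: tableau_ext; first by rewrite sh.
  move=> p q _; have := congr1 (fun V => entry V p q) e; rewrite /= !entry_set_entry.
  by case: andP => [[/eqP -> /eqP ->]|//]; rewrite en en'.
have e : iter (rank k (set_entry T i j 0, (i, j))) step (set_entry T i j 0, (i, j)) =
  iter (rank k (set_entry T' i' j' 0, (i', j'))) step (set_entry T' i' j' 0, (i', j')).
  by rewrite /rank /= e1 e1' eU.
have v : valid k (set_entry T i j 0, (i, j)) by exists B.
have v' : valid k (set_entry T' i' j' 0, (i', j')) by exists B'.
case: (leqP (rank k (set_entry T i j 0, (i, j))) (rank k (set_entry T' i' j' 0, (i', j')))) => r.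
  exact: (iter_rank_inj _ _ _ v v').
by symmetry; apply: (iter_rank_inj _ _ _ v' v) => //; apply: ltnW.
Qed.

Lemma ready_fold k T ds : ready k T ds ->
  ready (k + size ds) (foldl slide_dot T ds) [::] /\
  sumn (flatten (foldl slide_dot T ds)) + n * size ds = sumn (flatten T).
Proof.
elim: ds k T => [|d ds IH] k T rT /=; first by rewrite addn0 muln0 addn0.
by have [r e] := ready_step _ _ _ _ rT; have [] := IH _ _ r; rewrite addSnnS mulnS; split=> //; lia.
Qed.

Lemma ready_fold_inj k T T' ds ds' : size ds = size ds' -> ready k T ds -> ready k T' ds' ->
  foldl slide_dot T ds = foldl slide_dot T' ds' -> T = T'.
Proof.
elim: ds ds' k T T' => [|d ds IH] [|d' ds'] //= k T T' [sz] rT rT' e.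
apply: (slide_dot_inj _ _ _ _ _ _ _ rT rT').
by apply: (IH ds' k.+1) => //; [have [] := ready_step _ _ _ _ rT | have [] := ready_step _ _ _ _ rT'].
Qed.

(** * Comparison with the definition of promotion *)

Definition mask (T : tableau) : tableau :=
  [seq [seq if x == n then 0 else x | x <- row] | row <- T].

Lemma shape_mask T : shape (mask T) = shape T.
Proof. by rewrite /shape /mask -map_comp; apply: eq_map => row /=; rewrite size_map. Qed.

Lemma entry_map (f : nat -> nat) (T : tableau) i j : j < size (nth [::] T i) ->
  entry [seq [seq f x | x <- row] | row <- T] i j = f (entry T i j).
Proof.
move=> h; have iT := row_lt_size _ _ _ h.
by rewrite /entry (nth_map [::]) // (nth_map 0).
Qed.

Lemma entry_mask T i j : entry (mask T) i j = if entry T i j == n then 0 else entry T i j.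
Proof.
case: (ltnP j (size (nth [::] T i))) => h; first exact: entry_map.
rewrite !entry_default //; last by rewrite -nth_shape shape_mask nth_shape.
by case: eqP.
Qed.

Lemma mask_set_entry T i j x : shape T = la -> cell i j -> x < n ->
  mask (set_entry T i j x) = set_entry (mask T) i j x.
Proof.
move=> sh c xn.
have sh1 : shape (set_entry T i j x) = la by rewrite shape_set_entry // -nth_shape sh.
apply: tableau_ext.
  by rewrite shape_set_entry ?shape_mask ?sh1 ?sh // -nth_shape shape_mask sh.
move=> p q _; rewrite !(entry_mask, entry_set_entry).
by case: (_ && _) => //; case: eqP => //; lia.
Qed.

(** A slide only looks at boxes northwest of its dot, where no n stands, so it does not notice
    whether the waiting dots are 0 or n. *)
Lemma slide_mask f T i j : shape T = la -> cell i j ->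
  (forall p q, p <= i -> q <= j -> entry T p q < n) ->
  slide f (mask T) i j = mask (slide f T i j).
Proof.
elim: f T i j => //= f IH T i j sh c lt.
have E p q : p <= i -> q <= j -> entry (mask T) p q = entry T p q.
  by move=> pi qj; rewrite entry_mask; have := lt _ _ pi qj; case: eqP => //; lia.
have -> : above (mask T) i j = above T i j by case: i E {c lt} => //= i E; rewrite E //; lia.
have -> : left_of (mask T) i j = left_of T i j by case: j E {c lt} => //= j E; rewrite E //; lia.
case: ifP => // nz; case: ifP => hl.
  case: i c lt E nz hl => [|i] c lt E nz hl; first by move: nz hl; rewrite /=; lia.
  rewrite /= -!mask_set_entry ?shape_set_entry -?nth_shape ?sh ?(cell_up _ _ c) //; last by apply: lt; lia.
  rewrite IH ?shape_move_dot ?(cell_up _ _ c) // => p q pi qj.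
  by rewrite entry_move_dot; split_eqs => //; apply: lt; lia.
case: j c lt E nz hl => [|j] c lt E nz hl; first by move: nz hl; rewrite /=; lia.
have c' : cell i j := ltnW c.
rewrite /= -!mask_set_entry ?shape_set_entry -?nth_shape ?sh //; last by apply: lt; lia.
rewrite IH ?shape_move_dot // => p q pi qj.
by rewrite entry_move_dot; split_eqs => //; apply: lt; lia.
Qed.

Lemma foldl_mask k T ds : ready k T ds ->
  foldl (fun U p => slide (p.1 + p.2) U p.1 p.2) (mask T) ds = mask (foldl slide_dot T ds).
Proof.
elim: ds k T => //= [[i j] ds] IH k T rT.
have [rT' _] := ready_step _ _ _ _ rT; rewrite -(IH _ _ rT'); congr foldl.
have [ce en _ [B h]] := ready_holed _ _ _ _ _ rT.
have sh := filled_shape _ _ (ready_filled _ _ _ rT).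
rewrite /slide_dot -slide_mask /=; last exact: (holed_lt _ _ _ _ _ h).
- congr slide; rewrite mask_set_entry //; apply: tableau_ext.
    by rewrite shape_set_entry // -nth_shape shape_mask sh.
  move=> p q _; rewrite entry_set_entry.
  by case: andP => [[/eqP-> /eqP->]|//]; rewrite entry_mask en eqxx.
- exact: holed_shape h.
- exact: ce.
Qed.

Lemma SST_ready T : SST n la T -> ready 0 T (dots n T).
Proof.
move=> /SSTP[sh rg row col].
have memE p q : ((p, q) \in dots n T) = (entry T p q == n).
  rewrite mem_filter /=; case: eqP => //= en.
  have c : cell p q.
    by case: (ltnP q (nth 0 la p)) => // c; move: en; rewrite entry_out //; lia.
  have pT : p < size T by apply: (row_lt_size _ _ q); rewrite -nth_shape sh.
  apply/allpairsP; exists (q, p); split; rewrite ?mem_iota //= add0n -nth0 -nth_shape sh.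
  by elim: p c {en pT} => // p IH c; apply: IH; apply: cell_up.
split=> //; first split=> //.
- by move=> p q /rg; lia.
- by move=> p q /rg; rewrite ltn0 andbF; lia.
(* [dots] runs through the columns from left to right and through each column downwards. *)
- pose lex (d d' : nat * nat) := (d.2 < d'.2) || ((d.2 == d'.2) && (d.1 < d'.1)).
  have plex : pairwise lex (dots n T).
    suff H l m : pairwise lex [seq (i, j) | j <- iota m l, i <- iota 0 (size T)].
      exact: subseq_pairwise (filter_subseq _ _) (H _ _).
    elim: l m => //= l IH m; rewrite pairwise_cat IH andbT.
    apply/andP; split.
      apply/allrelP => d d' /mapP[p _ ->] /allpairsP[[q' p'] /= [h _ ->]].
      by move: h; rewrite mem_iota /lex /=; lia.
    rewrite pairwise_map; apply: (@sub_pairwise _ ltn).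
      by move=> p q /=; rewrite /lex /=; lia.
    by rewrite -sorted_pairwise ?iota_ltn_sorted //; apply: ltn_trans.
  have allm : all (mem (dots n T)) (dots n T) by apply/allP.
  apply: (@sub_in_pairwise _ (mem (dots n T)) lex _ _ _ allm plex).
  move=> [p q] [p' q'] /=; rewrite !memE => /eqP e /eqP e'.
  have c : cell p' q'.
    by case: (ltnP q' (nth 0 la p')) => // c; move: e'; rewrite entry_out //; lia.
  have up a b : a <= p' -> cell p' b -> cell a b.
    by move=> /subnKC <-; elim: (p' - a) => [|d IH]; rewrite ?addn0 // addnS => /cell_up.
  have colm a b : a < b -> b <= p' -> entry T a q' < entry T b q'.
    move=> + bp; elim: b bp => // b IH bp; rewrite ltnS leq_eqVlt => /orP[/eqP->|ab].
      by apply: col; apply: up c.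
    by apply: ltn_trans (IH (ltnW bp) ab) (col _ _ (up _ _ bp c)).
  have rowm b : q <= b -> cell p b -> entry T p q <= entry T p b.
    move=> /subnKC <-; elim: (b - q) => [|d IH]; rewrite ?addn0 // addnS => cd.
    exact: leq_trans (IH (ltnW cd)) (row _ _ cd).
  rewrite /lex /strip /= => /orP[qq|/andP[/eqP qq pp]]; last first.
    by have := colm p p' pp (leqnn _); subst q'; lia.
  (* If the second n were lower, the box in row [p] and column [q'] would hold an entry both at
     least n and less than n. *)
  rewrite qq leqNgt; apply/negP => pp.
  by have := colm p p' pp (leqnn _); have := rowm q' (ltnW qq) (up _ _ (ltnW pp) c); lia.
(* There is no previous dot: for [B] = 0 the conditions hold trivially. *)
- by move=> d ds' _; exists (fun=> 0); split.
Qed.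

Lemma promotionE T : SST n la T ->
  promotion n T = [seq [seq x.+1 | x <- row] | row <- foldl slide_dot T (dots n T)].
Proof.
move=> hT; have rT := SST_ready _ hT; have [rF _] := ready_fold _ _ _ rT.
rewrite /promotion -/(mask T) (foldl_mask _ _ _ rT).
set F := foldl _ _ _ in rF *.
(* No dot is waiting any more, so no entry n is left. *)
have -> : mask F = F.
  apply: tableau_ext => [|p q _]; first exact: shape_mask.
  by rewrite entry_mask; have := ready_dots _ _ _ rF p q; case: eqP.
by do 2 apply: eq_map => ?; case: eqP => [->|]; rewrite ?addn1.
Qed.

Lemma SST_promotion T : SST n la T -> SST n la (promotion n T).
Proof.
move=> hT; have rT := SST_ready _ hT; have [rF _] := ready_fold _ _ _ rT.
rewrite promotionE //; move: (foldl _ _ _) rF => F [[sh _ le zero row col] mem _ _].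
have E p q : cell p q -> entry [seq [seq x.+1 | x <- r] | r <- F] p q = (entry F p q).+1.
  by move=> c; rewrite entry_map // -nth_shape sh.
apply/SSTP; split.
- by rewrite -sh /shape -map_comp; apply: eq_map => r /=; rewrite size_map.
- by move=> p q c; rewrite E //; have := le _ _ c; have := mem p q; rewrite in_nil; lia.
- by move=> p q c; rewrite (E _ _ c) (E _ _ (ltnW c)) ltnS; apply: row.
- by move=> p q c; rewrite (E _ _ c) (E _ _ (cell_up _ _ c)) ltnS; apply: col.
Qed.

Lemma promotion_inj T T' : SST n la T -> SST n la T' -> promotion n T = promotion n T' -> T = T'.
Proof.
move=> hT hT'; have rT := SST_ready _ hT; have rT' := SST_ready _ hT'.
rewrite !promotionE // => /(inj_map (inj_map succn_inj)) e.
apply: (ready_fold_inj _ _ _ _ _ _ rT rT' e).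
have [[fF _ _ _] _] := ready_fold _ _ _ rT; have [[fF' _ _ _] _] := ready_fold _ _ _ rT'.
rewrite e !add0n in fF fF'.
(* The number of dots is the number of zeros in the first row of the result. *)
move: (size _) (size _) (foldl _ _ _) fF fF' {e} => a b F [_ ta _ za _ _] [_ tb _ zb _ _].
case: (ltngtP a b) => // ab.
  have c : cell 0 a by lia.
  by have := za 0 a c; rewrite zb //; lia.
have c : cell 0 b by lia.
by have := za 0 b c; rewrite zb //; lia.
Qed.

(** Every dot takes n off the sum, and the final shift adds 1 in each box. *)
Lemma sumn_promotion T : SST n la T ->
  sumn (flatten (promotion n T)) = sumn (flatten T) + sumn la %[mod n].
Proof.
move=> hT; have rT := SST_ready _ hT; have [rF e] := ready_fold _ _ _ rT.
have sh := filled_shape _ _ (ready_filled _ _ _ rF).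
rewrite promotionE //; move: (foldl _ _ _) e sh => F <- <-.
have -> : sumn (flatten [seq [seq x.+1 | x <- r] | r <- F]) = sumn (flatten F) + sumn (shape F).
  rewrite !sumn_flatten_shape; elim: F => //= r F ->.
  suff -> : sumn [seq x.+1 | x <- r] = sumn r + size r by lia.
  by elim: r => //= x r ->; lia.
by rewrite [in RHS]addnAC [in RHS]addnC mulnC modnMDl.
Qed.
End Promotion.

(** * Orbits and orders *)

(** Each s_i transposes two parts of the content, and the product of these transpositions is a cycle
    on m, ..., m+l. *)
Lemma count_foldr_reflection m l T k :
  count_mem k (flatten (foldr reflection T (iota m l))) =
  count_mem (if k == m then m + l else if m < k <= m + l then k.-1 else k) (flatten T).
Proof.
elim: l m T k => [|l IH] m T k /=.
  case: eqP => [->|?]; first by rewrite addn0.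
  by case: ifP => //; lia.
rewrite count_reflection IH; congr (count_mem _ _).
by case: (k =P m) => ?; [|case: (k =P m.+1) => ?]; decide_eqs; do ?case: ifP => ?; lia.
Qed.

(** When s_k is applied, the letters k+1 are as many as the letters m+l of [T], and the letters k as
    many as in [T]. For m = 1 and l = n-1 the sum changes by |la| modulo n. *)
Lemma sumn_foldr_reflection m l T :
  sumn (flatten (foldr reflection T (iota m l))) + l * count_mem (m + l) (flatten T) =
  sumn (flatten T) + \sum_(m <= k < m + l) count_mem k (flatten T).
Proof.
elim: l m => [|l IH] m /=; first by rewrite addn0 mul0n big_geq ?addn0.
have := sumn_reflection m (foldr reflection T (iota m.+1 l)); rewrite !count_foldr_reflection.
decide_eqs; rewrite (_ : m.+1 < m <= _ = false); last by lia.
rewrite big_ltn; last by lia.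
have := IH m.+1; rewrite addSnnS mulSn.
by move: (sumn _) (sumn _) (sumn _) (count_mem _ _) (count_mem _ _) (\sum_(_ <= _ < _) _) => *; lia.
Qed.

Lemma sum_count_mem n (s : seq nat) : all (fun x => 1 <= x <= n) s ->
  \sum_(1 <= k < n.+1) count_mem k s = size s.
Proof.
elim: s => [|x s IH] /=; first by rewrite big1.
case/andP=> hx hs; rewrite big_split /= IH //; suff -> : \sum_(1 <= k < n.+1) (x == k) = 1 by [].
rewrite (bigD1_seq x) ?iota_uniq ?mem_index_iota //= eqxx big1 // => k.
by rewrite eq_sym => /negbTE ->.
Qed.

(** * Finiteness, periods and orbits *)

Section Fixed.
Variables (n : nat) (la : seq nat).
Hypotheses (n_gt0 : 0 < n) (pla : is_partition la).

Lemma SST_crystal_c T : SST n la T -> SST n la (crystal_c n T).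
Proof.
rewrite /crystal_c; have : all (fun i => 0 < i < n) (iota 1 n.-1).
  by apply/allP => i; rewrite mem_iota; lia.
elim: (iota _ _) => //= i r IH /andP[hi hr] hT.
exact: SST_reflection (IH hr hT).
Qed.

Lemma sumn_crystal_c T : SST n la T ->
  sumn (flatten (crystal_c n T)) = sumn (flatten T) + sumn la %[mod n].
Proof.
move=> [sh rg _ _].
have := @sum_count_mem n (flatten T); rewrite size_flatten sh => /(_ _) tot.
have {}tot : \sum_(1 <= k < n.+1) count_mem k (flatten T) = sumn la.
  by apply: tot; apply/allP => x /flattenP[row /rg/allP h /h].
have := sumn_foldr_reflection 1 n.-1 T; rewrite add1n prednK // -/(crystal_c n T).
move: tot; rewrite big_nat_recr //= => <-.
move: (count_mem n _) (\sum_(_ <= _ < _) _) => c s e.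
have -> : sumn (flatten T) + (s + c) = c * n + sumn (flatten (crystal_c n T)).
  by rewrite addnA -e -addnA -mulSnr prednK // addnC mulnC.
by rewrite modnMDl.
Qed.

Lemma finite_SST : finite_set (SST n la).
Proof.
pose f (t : (sumn la).-tuple 'I_n.+1) := reshape la (map val t).
apply: (sub_finite_set (B := range f)); last exact/finite_image/finite_finset.
move=> T [sh rg _ _].
have sz : size (map inord (flatten T) : seq 'I_n.+1) == sumn la.
  by rewrite size_map size_flatten sh.
exists (Tuple sz) => //; rewrite /f /= -map_comp.
rewrite -[RHS]flattenK sh; congr reshape; rewrite -[RHS]map_id.
apply/eq_in_map => x /flattenP[row /rg/allP h /h] xn /=.
by rewrite inordK //; lia.
Qed.

Lemma iter_SST (f : tableau -> tableau) k T :
  (forall U, SST n la U -> SST n la (f U)) -> SST n la T -> SST n la (iter k f T).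
Proof. by move=> h hT; elim: k => //= k; apply: h. Qed.

Lemma iter_promotion_SST k T : SST n la T -> SST n la (iter k (promotion n) T).
Proof. by apply: iter_SST => U; apply: SST_promotion. Qed.

Lemma iter_promotion_inj k T T' : SST n la T -> SST n la T' ->
  iter k (promotion n) T = iter k (promotion n) T' -> T = T'.
Proof.
move=> hT hT'; elim: k => //= k IH e; apply: IH.
by apply: (promotion_inj _ _ n_gt0 pla) e; apply: iter_promotion_SST.
Qed.

Lemma sumn_iter (f : tableau -> tableau) k T :
  (forall U, SST n la U -> SST n la (f U)) ->
  (forall U, SST n la U -> sumn (flatten (f U)) = sumn (flatten U) + sumn la %[mod n]) ->
  SST n la T -> sumn (flatten (iter k f T)) = sumn (flatten T) + k * sumn la %[mod n].
Proof.
move=> h1 h2 hT; elim: k => [|k IH]; first by rewrite mul0n addn0.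
rewrite iterS h2; last exact: iter_SST.
by rewrite -modnDml IH modnDml -addnA -mulSnr.
Qed.

Lemma promotion_periodic : exists2 m, 0 < m &
  forall T, SST n la T -> iter m (promotion n) T = T.
Proof.
have /finite_seqP[s es] := finite_SST.
have mem T : SST n la T -> T \in s by rewrite es.
(* By the pigeonhole principle each tableau returns after at most [size s] steps, a number that
   divides the factorial. *)
exists (size s)`!; first exact: fact_gt0.
move=> T hT.
have [a [b [ab bs e]]] : exists a b, [/\ a < b, b <= size s &
    iter a (promotion n) T = iter b (promotion n) T].
  apply: contrapT => H.
  have u : uniq [seq iter k (promotion n) T | k <- iota 0 (size s).+1].
    rewrite map_inj_in_uniq ?iota_uniq // => a b; rewrite !mem_iota => ha hb e.
    by case: (ltngtP a b) => // ab; case: H; [exists a, b | exists b, a]; split=> //; lia.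
  have := @uniq_leq_size _ _ s u.
  rewrite size_map size_iota ltnn; case/(_ _)/Bool.diff_false_true => U /mapP[k _ ->].
  exact/mem/iter_promotion_SST.
have e' : iter (b - a) (promotion n) T = T.
  apply: (iter_promotion_inj a) => //; first exact: iter_promotion_SST.
  by rewrite -iterD subnKC // ltnW.
have /dvdnP[q ->] : b - a %| (size s)`! by apply: dvdn_fact; lia.
by elim: q => // q IH; rewrite mulSn iterD IH.
Qed.

Hypothesis cop : coprime n (sumn la).

Lemma iter_promotion_fixed k T : SST n la T -> iter k (promotion n) T = T -> n %| k.
Proof.
move=> hT e; have := sumn_iter (promotion n) k T.
rewrite e => /(_ (SST_promotion _ _ n_gt0 pla) (sumn_promotion _ _ n_gt0 pla) hT)/eqP.
by rewrite -{1}[sumn (flatten T)]addn0 eqn_modDl mod0n eq_sym -/(dvdn _ _) Gauss_dvdl.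
Qed.

Lemma iter_mod (X : Type) (f : X -> X) m k x : iter m f x = x -> iter k f x = iter (k %% m) f x.
Proof.
move=> e; rewrite {1}(divn_eq k m) addnC iterD; congr iter.
by elim: (k %/ m) => // q IH; rewrite mulSn iterD IH.
Qed.

Lemma card_orbits T : SST n la T -> orbit_pr n T #= orbit_CP n T.
Proof.
move=> hT; have [M M0 hM] := promotion_periodic.
(* The least such [m] is the length of the orbit of [T] under pr^n; both orbits are put in bijection
   with the numbers below m n. *)
pose P m := (0 < m) && (iter (m * n) (promotion n) T == T).
have exP : exists m, P m.
  exists M; rewrite /P M0; apply/eqP.
  by rewrite (iter_mod _ _ M) ?hM // modnMr.
case: (ex_minnP exP) => m /andP[m0 /eqP em] min.
have inj_pr a b : a < m * n -> b < m * n ->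
    iter a (promotion n) T = iter b (promotion n) T -> a = b.
  wlog ab : a b / a <= b.
    by move=> H ha hb e; case: (leqP a b) => ab; [apply: H | symmetry; apply: H => //; apply: ltnW].
  move=> ha hb e.
  have e' : iter (b - a) (promotion n) T = T.
    apply: (iter_promotion_inj a) => //; first exact: iter_promotion_SST.
    by rewrite -iterD subnKC.
  have /dvdnP[q eq] := iter_promotion_fixed _ _ hT e'.
  have [q0|q0] := posnP q; first by move: eq; rewrite q0; lia.
  have : m <= q by apply: min; rewrite /P q0 -eq e' eqxx.
  by rewrite -(leq_pmul2r n_gt0) -eq; lia.
have -> : orbit_pr n T = ((fun q => iter q (promotion n) T) @` `I_(m * n))%classic.
  apply/seteqP; split=> U; last by case=> q _ <-; exists q.
  case=> k ->; exists (k %% (m * n)); last by rewrite -iter_mod.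
  by rewrite /= ltn_mod muln_gt0 m0.
(* The remainder of [q] gives the exponent of c, the quotient that of pr^n. *)
pose h q := iter (q %% n) (crystal_c n) (iter (q %/ n * n) (promotion n) T).
have -> : orbit_CP n T = (h @` `I_(m * n))%classic.
  apply/seteqP; split=> U; last by case=> q _ <-; exists (q %% n), (q %/ n).
  case=> a [b ->]; exists (b %% m * n + a %% n).
    rewrite /=; have := ltn_pmod a n_gt0; have := ltn_pmod b m0.
    by rewrite -(leq_pmul2r n_gt0) mulSn; lia.
  rewrite /h modnMDl modn_mod divnMDl // divn_small ?ltn_pmod // addn0.
  rewrite -(iter_mod _ _ n) ?crystal_c_order //; congr iter.
  by rewrite muln_modl -iter_mod.
apply: card_eq_trans (inj_card_eq _) _.
  by move=> a b /[!inE] /= ha hb; apply: inj_pr.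
rewrite card_eq_sym; apply: inj_card_eq => a b /[!inE] /= ha hb e.
have hp q := iter_promotion_SST (q %/ n * n) _ hT.
have sh q : sumn (flatten (h q)) = sumn (flatten T) + q * sumn la %[mod n].
  rewrite (sumn_iter _ _ _ SST_crystal_c sumn_crystal_c (hp q)) -modnDml.
  rewrite (sumn_iter _ _ _ (SST_promotion _ _ n_gt0 pla) (sumn_promotion _ _ n_gt0 pla) hT).
  by rewrite modnDml -addnA -mulnDl -divn_eq.
(* The sum of the entries modulo n determines the exponent of c. *)
have ab : a = b %[mod n].
  have := sh a; rewrite e sh => /eqP; rewrite eqn_modDl.
  wlog le : a b {ha hb e} / a <= b.
    by move=> H; case: (leqP a b) => [|/ltnW] ab; [apply: H | rewrite eq_sym => H'; symmetry; apply: H].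
  rewrite eqn_mod_dvd ?leq_mul2r ?le ?orbT // -mulnBl Gauss_dvdl // -eqn_mod_dvd //.
  by move/eqP.
have c_inj k : injective (iter k (crystal_c n)).
  elim: k => // k IH U V /= e'; apply: IH.
  have cK : cancel (crystal_c n) (iter n.-1 (crystal_c n)).
    by move=> W; rewrite -iterSr prednK // crystal_c_order.
  exact: can_inj cK _ _ e'.
rewrite /h ab in e; move/c_inj: e => /inj_pr e.
have le q : q < m * n -> q %/ n * n < m * n by move=> hq; apply: leq_ltn_trans (leq_divM q n) hq.
by rewrite (divn_eq a n) (divn_eq b n) ab e // le.
Qed.

(** Every row is filled with its number, counted from 1. Some tableau is needed to show that n
    divides the order. *)
Lemma SST_nonempty : size la <= n -> exists T, SST n la T.
Proof.
move=> hl; exists (mkseq (fun i => nseq (nth 0 la i) i.+1) (size la)).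
have E i j : j < nth 0 la i ->
    entry (mkseq (fun i => nseq (nth 0 la i) i.+1) (size la)) i j = i.+1.
  move=> c; rewrite /entry nth_mkseq ?nth_nseq ?c //.
  by rewrite ltnNge; apply/negP => /(nth_default 0) e; rewrite e in c.
apply/SSTP; split.
- apply: (@eq_from_nth _ 0); first by rewrite !size_map size_iota.
  move=> i; rewrite size_map size_mkseq => hi.
  by rewrite nth_shape nth_mkseq // size_nseq.
- move=> i j c; rewrite E //=; apply: leq_trans hl.
  by rewrite ltnNge; apply/negP => /(nth_default 0) e; rewrite e in c.
- by move=> i j c; rewrite !E // ltnW.
- by move=> i j c; rewrite !E //; apply: leq_trans c (partition_nth_le _ _ pla).
Qed.
End Fixed.

(** * Orders and least common multiples *)

Lemma is_order_dvd (X : Type) (f : X -> X) (A : set X) m k : is_order f A m ->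
  (forall x, A x -> iter k f x = x) -> m %| k.
Proof.
case=> m0 hm min hk; case: (posnP (k %% m)) => [/eqP //|r0].
suff : m <= k %% m by rewrite leqNgt ltn_mod m0.
by apply: min => // x Ax; rewrite -iter_mod ?hk ?hm.
Qed.

(** One positive period guarantees that [order_on] does not take its default value 0. *)
Lemma order_onP (X : Type) (f : X -> X) (A : set X) m : 0 < m ->
  (forall x, A x -> iter m f x = x) -> is_order f A (order_on f A).
Proof.
move=> m0 hm; pose P k := (0 < k) && `[< forall x, A x -> iter k f x = x >].
have exP : exists k, P k by exists m; rewrite /P m0; apply/asboolP.
case: (ex_minnP exP) => k /andP[k0 /asboolP hk] min.
apply: xgetPex; exists k; split=> // l l0 hl.
by apply: min; rewrite /P l0; apply/asboolP.
Qed.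

Section BigLcm.
Variables (I : eqType) (F : I -> nat).

Lemma dvdn_biglcm_seq (s : seq I) x : x \in s -> F x %| \big[lcmn/1]_(y <- s) F y.
Proof.
elim: s => // y s IH; rewrite inE big_cons => /orP[/eqP->|/IH h]; first exact: dvdn_lcml.
exact: dvdn_trans h (dvdn_lcmr _ _).
Qed.

Lemma biglcm_seq_dvdn (s : seq I) k : (forall x, x \in s -> F x %| k) ->
  \big[lcmn/1]_(y <- s) F y %| k.
Proof.
move=> h; rewrite big_seq; elim/big_rec: _ => [|x m xs hm]; first exact: dvd1n.
by rewrite dvdn_lcm h.
Qed.

Lemma biglcm_seq_gt0 (s : seq I) : (forall x, x \in s -> 0 < F x) ->
  0 < \big[lcmn/1]_(y <- s) F y.
Proof.
by move=> h; rewrite big_seq; elim/big_rec: _ => // x m xs hm; rewrite lcmn_gt0 h.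
Qed.
End BigLcm.

Theorem theorem4p6 (n : nat) (la : seq nat)
  (hn : 2 <= n)
  (hla : is_partition la)
  (hlen : size la < n)
  (hgcd : gcdn n (sumn la) = 1)
  (hcomm : forall i, 1 <= i <= n - 1 -> forall T, SST n la T ->
     reflection i (iter n (promotion n) T) = iter n (promotion n) (reflection i T)) :
  (forall T, SST n la T -> orbit_pr n T #= orbit_CP n T) /\
  is_order (promotion n) (SST n la)
    (n * \big[lcmn/1]_(al \in contents_plus n la)
           order_on (iter n (promotion n)) (SST_content n la al)).
Proof.
have n0 : 0 < n := ltnW hn.
have cop : coprime n (sumn la) by apply/eqP.
split; first by move=> T; apply: card_orbits.
have finc : finite_set (contents_plus n la).
  apply: (sub_finite_set (B := (content n @` SST n la)%classic)).
  2: exact/finite_image/finite_SST.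
  by move=> al [[T hT <-] _]; exists T.
pose o al := order_on (iter n (promotion n)) (SST_content n la al).
(* Over a finite set the operator becomes an iterated lcm over a list without repetitions. *)
have [r memc -> {finc}] : exists2 r : seq (n.-tuple nat),
    (forall al, al \in r <-> contents_plus n la al) &
    \big[lcmn/1]_(al \in contents_plus n la) o al = \big[lcmn/1]_(al <- r) o al.
  have /finite_seqP[s es] := finc; exists (undup s) => [al|].
    by rewrite mem_undup es.
  have -> : contents_plus n la = [set` undup s]%classic.
    by rewrite es; apply/seteqP; split=> al /=; rewrite mem_undup.
  by symmetry; apply: fsbig_seq; apply: undup_uniq.
set L := \big[_/_]_(_ <- _) _.
have [M M0 hM] := promotion_periodic n la n0 hla.
have iterM_pr k T : iter k (iter n (promotion n)) T = iter (k * n) (promotion n) T.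
  by rewrite iterM.
have ho al : is_order (iter n (promotion n)) (SST_content n la al) (o al).
  apply: (order_onP _ _ _ M) => // T [hT _].
  by rewrite iterM_pr (iter_mod _ _ M) ?hM // modnMr.
have L0 : 0 < L by apply: biglcm_seq_gt0 => al _; have [] := ho al.
have reflect_iter k i T : 0 < i < n -> SST n la T ->
    reflection i (iter (k * n) (promotion n) T) = iter (k * n) (promotion n) (reflection i T).
  move=> hi hT; elim: k => [|k IH] //.
  rewrite mulSn iterD hcomm; [|lia|exact: iter_promotion_SST].
  by rewrite IH -iterD.
split; first by rewrite muln_gt0 n0.
(* Induction on the sum of the entries; a dominant content is the case settled by the definition of
   [L]. *)
- move=> T; rewrite mulnC; have [s] := ubnP (sumn (flatten T)); elim: s T => // s IH T.
  rewrite ltnS => hs hT.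
  have nthc k : k < n -> nth 0 (content n T) k = count_mem k.+1 (flatten T).
    by move=> kn; rewrite (nth_mktuple _ 0 (Ordinal kn)).
  have [dom|ndom] := boolP (sorted geq (content n T)).
    have /dvdnP[q ->] : o (content n T) %| L.
      by apply: dvdn_biglcm_seq; apply/memc; split=> //; exists T.
    have [_ h _] := ho (content n T).
    rewrite -iterM_pr (iter_mod _ _ (o (content n T))) ?modnMl //; exact: h.
  have [i hi lt] : exists2 i, 0 < i < n & count_mem i (flatten T) < count_mem i.+1 (flatten T).
    apply: contrapT => H; case/negP: ndom; apply/(sortedP 0) => i; rewrite size_tuple => hi.
    rewrite !nthc ?(ltnW hi) //= leqNgt; apply/negP => lt.
    by apply: H; exists i.+1.
  have := IH (reflection i T); have := sumn_reflection i T => e /(_ _ _) h.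
  (* s_i is injective and commutes with the power of pr^n, so it suffices that this power fixes the
     reflected tableau, whose sum is smaller. *)
  apply: (can_inj (reflectionK i)); rewrite reflect_iter // h //; first by lia.
  exact: SST_reflection.
(* The exponent [k] is a multiple q n, and the q-th power of pr^n is trivial on every content class,
   so [L] divides q. *)
- move=> k k0 hk; have [T hT] := SST_nonempty n la hla (ltnW hlen).
  have /dvdnP[q eq] := iter_promotion_fixed _ _ n0 hla cop _ _ hT (hk _ hT).
  apply: dvdn_leq => //; rewrite eq mulnC dvdn_pmul2r //.
  apply: biglcm_seq_dvdn => al _; apply: (is_order_dvd _ _ _ _ _ (ho al)) => U [hU _].
  by rewrite iterM_pr -eq hk.
Qed.
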